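(* Let $\Omega\subset\mathbb R^2$ be a bounded rational convex polygon, let $P\subset\Omega^\circ$ be a nonempty finite strongly generic configuration, and let $F_P=G_P0_\Omega$, $\Gamma_P=V(F_P)$. Then every edge $e$ of $\Gamma_P$ whose closure is contained in $\Omega^\circ$ has weight one, and for every (interior) vertex $v$ of $\Gamma_P$ the dual Newton polygon $Q_v=\partial^+F_P(v)$ contains no point of $\mathbb Z^2$ in its interior.
   Context: A bounded rational convex polygon is a compact convex polygon $\Omega\subset\mathbb R^2$ with nonempty interior $\Omega^\circ$, of the form $\Omega=\bigcap_{r=1}^s\{x:\langle n_r,x\rangle+a_r\ge0\}$ with primitive $n_r\in\mathbb Z^2$, $a_r\in\mathbb R$. An $\Omega$-tropical series is a continuous function $F:\Omega\to\mathbb R_{\ge0}$ with $F=0$ on $\partial\Omega$ which near every point of $\Omega^\circ$ has the form $F(x)=\min_{m\in A}(c_m+\langle m,x\rangle)$ with $A\subset\mathbb Z^2$ finite and $c_m\in\mathbb R$; it is concave. Its corner locus $V(F)\subset\Omega^\circ$ is the set of points where the minimum is attained by at least two distinct affine functions. For nonempty finite $P\subset\Omega^\circ$, the tropical relaxation $F_P=G_P0_\Omega$ is the pointwise infimum of all $\Omega$-tropical series $G$ with $P\subset V(G)$; it is itself such a series. For concave $F$, $\partial^+F(x)=\{p\in\mathbb R^2:F(y)\le F(x)+\langle p,y-x\rangle\ \forall y\in\Omega\}$. The linearity cells of $F_P$ are the closures of the maximal connected open subsets of $\Omega^\circ$ on which $F_P$ is affine; each has a gradient in $\mathbb Z^2$.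 $\Gamma_P$ is a finite embedded polyhedral graph, whose vertices are the points $v\in\Omega^\circ$ with $\partial^+F_P(v)$ two-dimensional and whose edges are the straight segments into which the vertices divide it; an edge $e$ separating cells of gradients $m_0,m_1$ has weight $w(e)\ge1$ where $m_1-m_0=w(e)n$ with $n\in\mathbb Z^2$ primitive. The gradient-labelled marked type of $P=(p_1,\dots,p_N)$ consists of the embedded face poset of this subdivision of $\Omega$ (cells, edges, vertices, incidences, cyclic orders), the gradient of each two-dimensional cell, all edge weights, all incidences with the sides and vertices of $\Omega$, and for each $i$ the face containing $p_i$ in its relative interior. $P$ (a set of $N$ distinct points of $\Omega^\circ$) is strongly generic if (i) every $p_i$ lies in the relative interior of an edge of $\Gamma_P$; (ii) distinct $p_i$ lie on distinct edges; (iii) the gradient-labelled marked type is unchanged under all sufficiently small independent perturbations of the points $p_i$. *)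

(* Defs.v *)
From HB Require Import structures.
From mathcomp Require Import all_boot all_order all_algebra.
From mathcomp Require Import all_classical all_reals all_analysis.
Set Implicit Arguments.
Unset Strict Implicit.
Unset Printing Implicit Defensive.
Import Order.TTheory GRing.Theory Num.Theory.
Import numFieldNormedType.Exports.
Local Open Scope classical_set_scope.
Local Open Scope ring_scope.

Notation plane R := (R * R)%type.
Notation lattice := (int * int)%type.

Definition primitive (n : lattice) : Prop := coprimez n.1 n.2.

Section Plane.
Context {R : realType}.

Definition zvec (m : lattice) : plane R := (m.1%:~R, m.2%:~R).

Definition pairing (p x : plane R) : R := p.1 * x.1 + p.2 * x.2.

Definition det2 (u v : plane R) : R := u.1 * v.2 - u.2 * v.1.

(* The affine hull of S is the whole plane. *)
Definition two_dimensional (S : set (plane R)) : Prop :=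
  exists p q r, [/\ S p, S q, S r & det2 (q - p) (r - p) != 0].

(* For nonzero vectors a, b, c: they point in three distinct directions met in
   the order a, b, c when turning counterclockwise.  The three successive
   angles add up to 2 pi, so at least two of them lie in ]0, pi[; for the
   clockwise order at least two of the determinants are negative. *)
Definition ccw_directions (a b c : plane R) : Prop :=
  [\/ 0 < det2 a b /\ 0 < det2 b c,
      0 < det2 b c /\ 0 < det2 c a
    | 0 < det2 c a /\ 0 < det2 a b].

Definition rational_polygon (Omega : set (plane R)) : Prop :=
  [/\ exists (s : nat) (n : 'I_s -> lattice) (a : 'I_s -> R),
        (forall r, primitive (n r)) /\
        Omega = [set x | forall r, 0 <= pairing (zvec (n r)) x + a r],
      compact Omega
    & Omega° !=set0].

Definition polygon_side (Omega S : set (plane R)) : Prop :=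
  exists (u : plane R) (a : R),
    [/\ u != 0,
        forall x, Omega x -> 0 <= pairing u x + a,
        S = [set x | Omega x /\ pairing u x + a = 0]
      & exists x y, [/\ S x, S y & x != y]].

Definition polygon_vertex (Omega : set (plane R)) (q : plane R) : Prop :=
  Omega q /\
  forall (x y : plane R) (t : R), Omega x -> Omega y -> 0 < t < 1 ->
    q = (1 - t) *: x + t *: y -> x = y.

End Plane.

(* Functions on Omega are total functions on the plane; only their values on
   Omega are ever used. *)
Section TropicalSeries.
Context {R : realType}.
Variable Omega : set (plane R).
Implicit Types (F : plane R -> R) (x y v : plane R) (U e f : set (plane R)).

Definition is_tropical_min (A : set lattice) (c : lattice -> R) y (t : R) :
    Prop :=
  (exists2 m, A m & t = c m + pairing (zvec m) y) /\
  (forall m, A m -> t <= c m + pairing (zvec m) y).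

Definition local_form F x (A : set lattice) (c : lattice -> R) : Prop :=
  finite_set A /\ \forall y \near x, is_tropical_min A c y (F y).

Definition tropical_series F : Prop :=
  [/\ {within Omega, continuous F},
      forall x, Omega x -> 0 <= F x,
      forall x, (Omega `\` Omega°) x -> F x = 0
    & forall x, Omega° x -> exists A c, local_form F x A c].

(* Whether two terms of a local form attain the minimum at x does not depend on
   the local form: if F is affine near x, a term that is >= F near x with
   equality at x is F itself. *)
Definition corner_locus F : set (plane R) :=
  [set x | Omega° x /\
    exists A c, local_form F x A c /\
      exists m0 m1, [/\ A m0, A m1, m0 != m1,
        F x = c m0 + pairing (zvec m0) x & F x = c m1 + pairing (zvec m1) x]].

Definition tropical_relaxation (P : set (plane R)) (x : plane R) : R :=
  inf [set G x | G in [set G | tropical_series G /\ P `<=` corner_locus G]].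

Definition superdifferential F x : set (plane R) :=
  [set p | forall y, Omega y -> F y <= F x + pairing p (y - x)].

(* Every face of the subdivision is represented by its relative interior; the
   face itself (for a cell, the closed linearity cell) is the closure. *)

Definition affine_on F U : Prop :=
  exists (p : plane R) (c : R), forall y, U y -> F y = c + pairing p y.

Definition affine_domain F U : Prop :=
  [/\ U !=set0, open U, connected U, U `<=` Omega° & affine_on F U].

Definition cells F : set (set (plane R)) :=
  [set U | affine_domain F U /\
    forall U', affine_domain F U' -> U `<=` U' -> U' = U].

Definition cell_gradient F U (m : lattice) : Prop :=
  exists c : R, forall y, U y -> F y = c + pairing (zvec m) y.

Definition graph_vertex F : set (plane R) :=
  [set v | Omega° v /\ two_dimensional (superdifferential F v)].

Definition vertex_faces F : set (set (plane R)) :=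
  [set [set v] | v in graph_vertex F].

(* Removing the vertices cuts the corner locus into disjoint open straight
   segments, its connected components. *)
Definition edges F : set (set (plane R)) :=
  [set connected_component (corner_locus F `\` graph_vertex F) x
    | x in corner_locus F `\` graph_vertex F].

Definition edge_weight F e (w : nat) : Prop :=
  exists U0 U1 m0 m1 n,
    [/\ [/\ cells F U0, cells F U1 & U0 <> U1],
        e `<=` closure U0 /\ e `<=` closure U1,
        cell_gradient F U0 m0 /\ cell_gradient F U1 m1
      & [/\ (0 < w)%N, primitive n & m1 - m0 = n *+ w]].

Definition faces F : set (set (plane R)) :=
  cells F `|` edges F `|` vertex_faces F.

(* The edges e1, e2, e3 leave v in counterclockwise order. *)
Definition ccw_at_vertex v e1 e2 e3 : Prop :=
  [/\ closure e1 v, closure e2 v & closure e3 v] /\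
  exists x1 x2 x3, [/\ e1 x1, e2 x2, e3 x3 &
    ccw_directions (x1 - v) (x2 - v) (x3 - v)].

(* The edges e1, e2, e3 follow each other counterclockwise on the boundary of
   the convex cell U: one point of each spans a positively oriented triangle. *)
Definition ccw_around_cell U e1 e2 e3 : Prop :=
  [/\ e1 `<=` closure U, e2 `<=` closure U & e3 `<=` closure U] /\
  exists x1 x2 x3, [/\ e1 x1, e2 x2, e3 x3 & 0 < det2 (x2 - x1) (x3 - x1)].

Definition face_poset_iso F F' (phi : set (plane R) -> set (plane R)) : Prop :=
  [/\ set_bij (cells F) (cells F') phi,
      set_bij (edges F) (edges F') phi,
      set_bij (vertex_faces F) (vertex_faces F') phi
    & forall f g, faces F f -> faces F g ->
        (closure f `<=` closure g <-> closure (phi f) `<=` closure (phi g))].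

Definition preserves_cyclic_orders F F' (phi : set (plane R) -> set (plane R)) :
    Prop :=
  forall e1 e2 e3, edges F e1 -> edges F e2 -> edges F e3 ->
    (forall v v', graph_vertex F v -> graph_vertex F' v' ->
       phi [set v] = [set v'] ->
       (ccw_at_vertex v e1 e2 e3 <->
        ccw_at_vertex v' (phi e1) (phi e2) (phi e3))) /\
    (forall U, cells F U ->
       (ccw_around_cell U e1 e2 e3 <->
        ccw_around_cell (phi U) (phi e1) (phi e2) (phi e3))).

Definition preserves_boundary_incidences F
    (phi : set (plane R) -> set (plane R)) : Prop :=
  forall f, faces F f ->
    (forall S, polygon_side Omega S ->
       (closure f `&` S !=set0 <-> closure (phi f) `&` S !=set0)) /\
    (forall q, polygon_vertex Omega q ->
       (closure f q <-> closure (phi f) q)).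

(* Equality of the gradient-labelled marked types of p and p'. *)
Definition same_type (N : nat) (p p' : 'I_N -> plane R) : Prop :=
  let F := tropical_relaxation (range p) in
  let F' := tropical_relaxation (range p') in
  exists phi : set (plane R) -> set (plane R),
    [/\ face_poset_iso F F' phi /\ preserves_cyclic_orders F F' phi,
        forall U m, cells F U ->
          (cell_gradient F U m <-> cell_gradient F' (phi U) m),
        forall e w, edges F e ->
          (edge_weight F e w <-> edge_weight F' (phi e) w),
        preserves_boundary_incidences F phi
      & forall i f, faces F f -> (f (p i) <-> phi f (p' i))].

Definition strongly_generic (N : nat) (p : 'I_N -> plane R) : Prop :=
  let F := tropical_relaxation (range p) in
  [/\ injective p /\ (forall i, Omega° (p i)),
      forall i, exists2 e, edges F e & e (p i),
      forall i j e, i != j -> edges F e -> e (p i) -> ~ e (p j)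
    & exists2 eps : R, 0 < eps &
        forall p' : 'I_N -> plane R,
          (forall i, ball (p i) eps (p' i)) -> same_type p p'].

End TropicalSeries.

(* Main.v *)
(* The family of tropical series with corners at P is closed under pairwise
   minima, so by compactness of Omega its infimum F is approximated, uniformly
   enough, by single competitors, and F need not be known to be a tropical series
   itself.  If an affine function l with integral gradient satisfies l >= F with
   contact set a compact subset of the interior avoiding P, then l - d can be
   inserted into a good competitor for some d > 0, so F <= l - d: this
   contradicts contact.  At a vertex v with a lattice point interior to the dual
   polygon, the contact set is {v}; for an interior edge of weight k > 1, with
   gradients m0 and m1 = m0 + k n, take the gradient m0 + n, whose contact set is
   the closed edge.

   If such an edge carries a marked point p_i, displace p_i across the edge to
   p_i + s u.  Every such configuration has the same type, hence an edge of the
   same kind through the displaced point; let c0(s), c1(s) be the constant terms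
   of the two adjacent cells.  Inserting the intermediate gradient with a corner
   at p_i + t u, for t near s, yields F_t <= F_s, so every s is a local maximum of
   c0 and of c1.  Functions all of whose points are local maxima have countable
   range, whereas c0 - c1 is an injective affine function of s. *)
Require Import Defs.
From mathcomp Require Import all_boot all_order all_algebra.
From mathcomp Require Import all_classical all_reals all_analysis.
From mathcomp Require Import ring lra.
Set Implicit Arguments.
Unset Strict Implicit.
Unset Printing Implicit Defensive.
Import Order.TTheory GRing.Theory Num.Theory.
Import numFieldNormedType.Exports.
Local Open Scope classical_set_scope.
Local Open Scope ring_scope.

(** * Integral affine functions along segments, and a minimum principle in one variable *)

Section Affine.
Context {R : realType}.
Implicit Types (x y z : plane R) (m : lattice) (c t : R).

Definition aff m c x : R := c + pairing (zvec m) x.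

Definition seg x y t : plane R := (1 - t) *: x + t *: y.

Lemma seg_fst x y t : (seg x y t).1 = (1 - t) * x.1 + t * y.1.
Proof. by []. Qed.

Lemma seg_snd x y t : (seg x y t).2 = (1 - t) * x.2 + t * y.2.
Proof. by []. Qed.

Lemma pairing_seg p x y t :
  pairing p (seg x y t) = (1 - t) * pairing p x + t * pairing p y.
Proof. by rewrite /pairing seg_fst seg_snd; ring. Qed.

Lemma aff_seg m c x y t :
  aff m c (seg x y t) = (1 - t) * aff m c x + t * aff m c y.
Proof. by rewrite /aff pairing_seg; ring. Qed.

Lemma seg0 x y : seg x y 0 = x.
Proof. by rewrite /seg subr0 scale1r scale0r addr0. Qed.

Lemma seg1 x y : seg x y 1 = y.
Proof. by rewrite /seg subrr scale1r scale0r add0r. Qed.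

Lemma cvg_fst2 x : fst y @[y --> x] --> x.1.
Proof. by move: x => [a b]; exact: cvg_fst. Qed.

Lemma cvg_snd2 x : snd y @[y --> x] --> x.2.
Proof. by move: x => [a b]; exact: cvg_snd. Qed.

Lemma pairing_continuous p : continuous (@pairing R p).
Proof.
move=> x; rewrite /pairing; apply: cvgD.
  by apply: cvgMl_tmp; exact: cvg_fst2.
by apply: cvgMl_tmp; exact: cvg_snd2.
Qed.

Lemma aff_continuous m c : continuous (aff m c).
Proof. by move=> x; apply: cvgD; [exact: cvg_cst|exact: pairing_continuous]. Qed.

Lemma seg_continuous x y : continuous (seg x y).
Proof.
move=> t; apply: cvgD; apply: cvgZr_tmp.
  by apply: cvgB; [exact: cvg_cst|exact: cvg_id].
exact: cvg_id.
Qed.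

Lemma near_lt (T : Type) (F : set_system T) {FF : Filter F} (f g : T -> R) a b :
  f @ F --> a -> g @ F --> b -> a < b ->
  \forall i \near F, f i < g i.
Proof.
move=> fa gb ab.
have h : (fun i => g i - f i) @ F --> b - a by exact: cvgB.
have := cvgr_gt _ h 0; rewrite subr_gt0 => /(_ _ ab).
by apply: filterS => i; rewrite subr_gt0.
Qed.

(** For [t < 1] the map sending [w] to [seg w y t] is a homothety of nonzero ratio [1 - t], with
    continuous inverse [h]. *)
Lemma near_seg x y t (Q : set (plane R)) : t < 1 ->
  (\forall w \near x, Q (seg w y t)) -> \forall z \near seg x y t, Q z.
Proof.
move=> t1 Qx; have t0 : 1 - t != 0 by rewrite subr_eq0 gt_eqF.
pose h z := (1 - t)^-1 *: (z - t *: y).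
have hx : h (seg x y t) = x.
  by rewrite /h /seg addrK scalerA mulVf// scale1r.
have hc : h z @[z --> seg x y t] --> x.
  rewrite -[in X in _ --> X]hx /h.
  apply: (@cvgZ _ _ _ _ _ (fun=> (1 - t)^-1) (fun z => z - t *: y)).
    exact: cvg_cst.
  by apply: (@cvgB _ _ _ _ _ id (fun=> t *: y)); [exact: cvg_id|exact: cvg_cst].
have H : \forall z \near seg x y t, Q (seg (h z) y t) := hc _ Qx.
move: H; apply: filterS => z.
suff -> : seg (h z) y t = z by [].
by rewrite /seg /h scalerA divff// scale1r subrK.
Qed.

(* A quadratic perturbation makes the minimum strict, which is incompatible
   with an affine majorant touching at the minimum. *)
Lemma ge0_of_touching (g : R -> R) :
  {within `[0, 1], continuous g} -> 0 <= g 0 -> 0 <= g 1 ->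
  (forall t, 0 < t < 1 ->
     exists a, \forall s \near t, g s <= g t + a * (s - t)) ->
  forall t, 0 <= t <= 1 -> 0 <= g t.
Proof.
move=> gc g0 g1 gt t0 t01; rewrite leNgt; apply/negP => gneg.
(* Since [t * (1 - t) < 1], the perturbed [h] is still negative at [t0], while it agrees with [g] at
   both endpoints; its minimum is therefore interior. *)
pose e := - g t0 / 2.
have e0 : 0 < e by rewrite /e; lra.
pose h t := g t + e * (t * (1 - t)).
have hc : {within `[0, 1], continuous h}.
  have qc : continuous (fun t : R => e * (t * (1 - t))).
    move=> t; apply: cvgMl_tmp; apply: cvgM; first exact: cvg_id.
    by apply: cvgB; [exact: cvg_cst|exact: cvg_id].
  by move=> t; apply: cvgD; [exact: gc|exact: (continuous_subspaceT qc)].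
have [c c01 hmin] := EVT_min ler01 hc.
have ht0 : h t0 < 0.
  have : t0 * (1 - t0) < 1 by move: t01 => /andP[? ?]; nra.
  by rewrite /h /e; nra.
have hcneg : h c < 0 by apply: le_lt_trans ht0; apply: hmin; rewrite in_itv.
have c01' : 0 < c < 1.
  move: c01; rewrite in_itv/= !le_eqVlt => /andP[/orP[/eqP c0|->]].
    by move: hcneg; rewrite -c0 /h; lra.
  by move=> /orP[/eqP c1|->]//; move: hcneg; rewrite c1 /h; lra.
have [a /nbhs_ballP[r /= r0 ar]] := gt c c01'.
(* Small enough that [c + d] and [c - d] lie in the unit interval and in the range of the majorant;
   adding [h1] and [h2] then cancels the slope [a] and leaves [e * d ^+ 2 <= 0]. *)
pose d := Num.min (r / 2) (Num.min (c / 2) ((1 - c) / 2)).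
have [d0 dr dc dc1] : [/\ 0 < d, d < r, d < c & d < 1 - c].
  by move: c01' => /andP[? ?]; rewrite /d !lt_min !gt_min; split;
    rewrite ?(ltr_pdivrMr, divr_gt0, andbT)//; lra.
have hd s : `|c - s| < r -> 0 <= s <= 1 ->
    h c <= g c + a * (s - c) + e * (s * (1 - s)).
  move=> cs s01; apply: le_trans (hmin s _) _; first by rewrite in_itv.
  by rewrite /h lerD2r; exact: ar.
have h1 : h c <= g c + a * (c + d - c) + e * ((c + d) * (1 - (c + d))).
  by apply: hd; [rewrite opprD addrA subrr sub0r normrN gtr0_norm|lra].
have h2 : h c <= g c + a * (c - d - c) + e * ((c - d) * (1 - (c - d))).
  by apply: hd; [rewrite opprD addrA subrr sub0r opprK gtr0_norm|lra].
have : 0 < e * d ^+ 2 by rewrite mulr_gt0// exprn_gt0.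
by move: h1 h2; rewrite /h; nra.
Qed.

End Affine.

(** At one small [t > 0] the local bound holds at [seg x y t]; combined with concavity between [x]
    and [y] it becomes the bound at [y] multiplied by [t]. *)
Lemma concave_le_aff {R : realType} (f : plane R -> R) x y m c :
  f x = aff m c x -> (\forall z \near x, f z <= aff m c z) ->
  (forall t, 0 <= t <= 1 -> (1 - t) * f x + t * f y <= f (seg x y t)) ->
  f y <= aff m c y.
Proof.
move=> fx fle conc.
have H0 : \forall z \near seg x y 0, f z <= aff m c z by rewrite seg0.
have H : \forall t \near 0, f (seg x y t) <= aff m c (seg x y t) :=
  seg_continuous H0.
have [t [t0 t1 ft]] :
    exists t, [/\ 0 < t, t < 1 & f (seg x y t) <= aff m c (seg x y t)].
  have : \forall t \near (0:R)^'+,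
      [/\ 0 < t, t < 1 & f (seg x y t) <= aff m c (seg x y t)].
    near=> t; split.
    - by near: t; exact: nbhs_right_gt.
    - by near: t; exact: nbhs_right_lt.
    - by near: t; exact: cvg_within.
  by move=> /filter_ex.
have t01 : 0 <= t <= 1 by rewrite !ltW.
have := le_trans (conc _ t01) ft; rewrite aff_seg fx lerD2l.
by rewrite ler_pM2l.
Unshelve. all: by end_near. Qed.

(** * Concavity of tropical series on the polygon *)

Section Polygon.
Context {R : realType}.
Variable Omega : set (plane R).
Hypothesis hOmega : rational_polygon Omega.
Implicit Types (x y z : plane R) (t : R).

Lemma polygon_compact : compact Omega.
Proof. by case: hOmega. Qed.

Lemma polygon_seg x y t : Omega x -> Omega y -> 0 <= t <= 1 ->
  Omega (seg x y t).
Proof.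
case: hOmega => -[s [n [a [_ ->]]]] _ _ /= Ox Oy /andP[t0 t1] r.
rewrite pairing_seg; have := Ox r; have := Oy r.
move: (pairing _ x) (pairing _ y) (a r) => u v w uw vw.
have -> : (1 - t) * u + t * v + w = (1 - t) * (u + w) + t * (v + w) by ring.
by rewrite addr_ge0// mulr_ge0// subr_ge0.
Qed.

Lemma polygon_seg_interior x y t : Omega° x -> Omega y -> 0 <= t < 1 ->
  Omega° (seg x y t).
Proof.
move=> Ox Oy /andP[t0 t1]; rewrite /interior; apply: near_seg => //.
by apply: filterS Ox => w Ow; apply: polygon_seg => //; rewrite t0 ltW.
Qed.

Lemma tropical_near_le (G : plane R -> R) x : tropical_series Omega G ->
  Omega° x -> exists m c, G x = aff m c x /\ \forall y \near x, G y <= aff m c y.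
Proof.
move=> [_ _ _ lf] Ox; have [A [c [_ loc]]] := lf _ Ox.
have [[m Am Gx] _] := nbhs_singleton loc.
exists m, (c m); split => //.
by apply: filterS loc => y [_ /(_ _ Am)].
Qed.

(** A local form supplies an affine majorant touching at each interior point, so [ge0_of_touching]
    applies to the difference [g] with the chord. Taking [x] interior keeps the open segment in the
    interior even when [y] is on the boundary. *)
Lemma tropical_concave (G : plane R -> R) x y t : tropical_series Omega G ->
  Omega° x -> Omega y -> 0 <= t <= 1 ->
  (1 - t) * G x + t * G y <= G (seg x y t).
Proof.
move=> sG Ox Oy t01; have [cG _ _ _] := sG.
have Ox' := interior_subset Ox.
pose g s := G (seg x y s) - ((1 - s) * G x + s * G y).
rewrite -subr_ge0 -/(g t); apply: (@ge0_of_touching _ g _ _ _ _ t t01).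
- apply/subspace_continuousP => s s01; apply: cvgB.
    move/subspace_continuousP : cG => /(_ (seg x y s)) cG.
    apply: cvg_comp (cG _); last by apply: polygon_seg.
    move=> Q QW.
    have H : \forall r \near s, Omega (seg x y r) -> Q (seg x y r) :=
      seg_continuous QW.
    by apply: filterS H => r Qr r01; apply: Qr; apply: polygon_seg.
  apply: cvg_within_filter; apply: cvgD.
    apply: cvgMr_tmp; apply: cvgB; [exact: cvg_cst|exact: cvg_id].
  by apply: cvgMr_tmp; exact: cvg_id.
- by rewrite /g seg0 subr0 mul1r mul0r addr0 subrr.
- by rewrite /g seg1 subrr mul0r mul1r add0r subrr.
- move=> s /andP[s0 s1].
  have Os : Omega° (seg x y s) by apply: polygon_seg_interior => //; rewrite ltW.
  have [m [c [Gs Gle]]] := tropical_near_le sG Os.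
  exists ((aff m c y - aff m c x) - (G y - G x)).
  have H : \forall r \near s, G (seg x y r) <= aff m c (seg x y r) :=
    seg_continuous Gle.
  apply: filterS H => r Gr.
  rewrite /g Gs; move: Gr; rewrite !aff_seg.
  by move: (G (seg _ _ _)) => w; lra.
Qed.

Lemma tropical_le_aff (G : plane R -> R) x y m c : tropical_series Omega G ->
  Omega° x -> Omega y -> G x = aff m c x ->
  (\forall z \near x, G z <= aff m c z) -> G y <= aff m c y.
Proof.
move=> sG Ox Oy Gx Gle; apply: (concave_le_aff Gx Gle) => t.
exact: tropical_concave.
Qed.

End Polygon.

(** * Pairwise minima of tropical series and their corners *)

Section TropicalMin.
Context {R : realType}.
Variable Omega : set (plane R).
Implicit Types (x y z : plane R) (t d : R) (m : lattice) (A : set lattice).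
Implicit Types (G : plane R -> R) (P Q : set (plane R)).

(** A local form carries a single constant per gradient, so the two constants of a shared gradient
    have to be merged. *)
Definition min_coef A1 (c1 : lattice -> R) A2 c2 m : R :=
  if m \in A1 then if m \in A2 then Num.min (c1 m) (c2 m) else c1 m else c2 m.

Lemma min_coefl A1 (c1 : lattice -> R) A2 c2 m : A1 m ->
  min_coef A1 c1 A2 c2 m <= c1 m.
Proof.
by rewrite /min_coef => /mem_set ->; case: ifP => // _; rewrite ge_min lexx.
Qed.

Lemma min_coefr A1 (c1 : lattice -> R) A2 c2 m : A2 m ->
  min_coef A1 c1 A2 c2 m <= c2 m.
Proof.
by rewrite /min_coef => /mem_set ->; case: ifP => // _; rewrite ge_min lexx orbT.
Qed.

Lemma min_coef_ge A1 (c1 : lattice -> R) A2 c2 m y t1 t2 :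
  (forall m, A1 m -> t1 <= c1 m + pairing (zvec m) y) ->
  (forall m, A2 m -> t2 <= c2 m + pairing (zvec m) y) ->
  (A1 `|` A2) m ->
  Num.min t1 t2 <= min_coef A1 c1 A2 c2 m + pairing (zvec m) y.
Proof.
move=> h1 h2; rewrite /min_coef => A12.
case: ifPn => [/set_mem /h1 m1|/negP m1].
  case: ifPn => [/set_mem /h2 m2|_]; last by rewrite ge_min m1.
  by case: (leP (c1 m) (c2 m)) => _; rewrite ge_min ?m1 ?m2 ?orbT.
have /h2 m2 : A2 m by case: A12 => // /mem_set.
by rewrite ge_min m2 orbT.
Qed.

Lemma is_tropical_min_min A1 (c1 : lattice -> R) A2 c2 y t1 t2 :
  is_tropical_min A1 c1 y t1 -> is_tropical_min A2 c2 y t2 ->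
  is_tropical_min (A1 `|` A2) (min_coef A1 c1 A2 c2) y (Num.min t1 t2).
Proof.
move=> [[m1 Am1 e1] h1] [[m2 Am2 e2] h2].
have ge m := @min_coef_ge A1 c1 A2 c2 m y _ _ h1 h2.
split => //; case: (leP t1 t2) => t12.
  exists m1; first by left.
  apply/eqP; rewrite eq_le; apply/andP; split.
    by have := ge m1 (or_introl Am1); rewrite (min_idPl t12).
  by rewrite e1 lerD2r; exact: min_coefl.
exists m2; first by right.
apply/eqP; rewrite eq_le; apply/andP; split.
  by have := ge m2 (or_intror Am2); rewrite (min_idPr (ltW t12)).
by rewrite e2 lerD2r; exact: min_coefr.
Qed.

Lemma local_form_min G1 G2 x A1 c1 A2 c2 :
  local_form G1 x A1 c1 -> local_form G2 x A2 c2 ->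
  local_form (fun y => Num.min (G1 y) (G2 y)) x
    (A1 `|` A2) (min_coef A1 c1 A2 c2).
Proof.
move=> [f1 n1] [f2 n2]; split; first by rewrite finite_setU.
by near=> y; apply: is_tropical_min_min; near: y.
Unshelve. all: by end_near. Qed.

Lemma local_form_aff m (c : R) x : local_form (aff m c) x [set m] (fun=> c).
Proof.
split; first exact: finite_set1.
by near=> y; split => [|_ ->//]; exists m.
Unshelve. all: by end_near. Qed.

(** The two active gradients may come from the same function, which keeps an existing corner, or one
    from each, which creates a new corner where the graphs cross. *)
Lemma corner_min G1 G2 x A1 c1 A2 c2 m0 m1 :
  Omega° x -> local_form G1 x A1 c1 -> local_form G2 x A2 c2 -> m0 != m1 ->
  (forall m, m = m0 \/ m = m1 ->
     (A1 m /\ c1 m + pairing (zvec m) x <= Num.min (G1 x) (G2 x)) \/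
     (A2 m /\ c2 m + pairing (zvec m) x <= Num.min (G1 x) (G2 x))) ->
  corner_locus Omega (fun y => Num.min (G1 y) (G2 y)) x.
Proof.
move=> Ox l1 l2 m01 act; split => //.
exists (A1 `|` A2), (min_coef A1 c1 A2 c2).
have lf := local_form_min l1 l2; split => //.
have [_ ge] := nbhs_singleton lf.2.
have actE m : m = m0 \/ m = m1 -> (A1 `|` A2) m /\
    Num.min (G1 x) (G2 x) = min_coef A1 c1 A2 c2 m + pairing (zvec m) x.
  move=> /act act'; have Am : (A1 `|` A2) m.
    by case: act' => -[Am _]; [left|right].
  split => //; apply/eqP; rewrite eq_le ge//=.
  case: act' => -[{}Am]; apply: le_trans; rewrite lerD2r.
    exact: min_coefl.
  exact: min_coefr.
exists m0, m1.
by have [? ?] := actE m0 (or_introl erefl);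
   have [? ?] := actE m1 (or_intror erefl).
Qed.

Lemma corner_minl G1 G2 x A2 c2 : corner_locus Omega G1 x ->
  local_form G2 x A2 c2 -> G1 x <= G2 x ->
  corner_locus Omega (fun y => Num.min (G1 y) (G2 y)) x.
Proof.
move=> [Ox [A1 [c1 [l1 [m0 [m1 [A0 A1' m01 e0 e1]]]]]]] l2 G12.
apply: (corner_min Ox l1 l2 m01) => m; rewrite (min_idPl G12).
by case=> ->; left; rewrite -?e0 -?e1.
Qed.

Lemma corner_minr G1 G2 x A1 c1 : corner_locus Omega G2 x ->
  local_form G1 x A1 c1 -> G2 x <= G1 x ->
  corner_locus Omega (fun y => Num.min (G1 y) (G2 y)) x.
Proof.
move=> c2 l1 G21; have := corner_minl c2 l1 G21.
by under eq_fun do rewrite minC.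
Qed.

(** The last hypothesis is shaped for an affine [G2], which may be negative or nonzero on the
    boundary as long as it lies above [G1] there. *)
Lemma tropical_series_min G1 G2 : tropical_series Omega G1 ->
  {within Omega, continuous G2} ->
  (forall x, Omega° x -> exists A c, local_form G2 x A c) ->
  (forall x, Omega x -> G1 x <= G2 x \/ Omega° x /\ 0 <= G2 x) ->
  tropical_series Omega (fun y => Num.min (G1 y) (G2 y)).
Proof.
move=> [c1 p1 z1 l1] c2 l2 G12; split.
- by move=> x; apply: continuous_min; [exact: c1|exact: c2].
- move=> x Ox; rewrite le_min p1//=; case: (G12 x Ox) => [|[]//].
  by apply: le_trans; exact: p1.
- move=> x [Ox nOx]; case: (G12 x Ox) => [/min_idPl ->|[]//].
  exact: z1.
- move=> x Ox; have [A1 [e1 h1]] := l1 x Ox; have [A2 [e2 h2]] := l2 x Ox.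
  by do 2 eexists; exact: local_form_min h1 h2.
Qed.

Definition admissible P G := tropical_series Omega G /\
  P `<=` corner_locus Omega G.

Lemma admissible_min P G1 G2 : admissible P G1 -> admissible P G2 ->
  admissible P (fun y => Num.min (G1 y) (G2 y)).
Proof.
move=> [s1 k1] [s2 k2]; split.
  apply: (tropical_series_min s1); case: s2 => // c2 p2 z2 l2 x Ox.
  case: (pselect (Omega° x)) => Ox'; first by right; split; rewrite ?p2.
  by left; case: s1 => _ _ z1 _; rewrite z1// z2.
move=> x Px; have [? _] := k1 x Px.
have [A1 [e1 h1]] : exists A c, local_form G1 x A c by case: s1 => _ _ _; apply.
have [A2 [e2 h2]] : exists A c, local_form G2 x A c by case: s2 => _ _ _; apply.
case: (leP (G1 x) (G2 x)) => G12.
  by apply: (corner_minl _ h2) => //; exact: k1.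
by apply: (corner_minr _ h1); [exact: k2|exact: ltW].
Qed.

End TropicalMin.

(** * The relaxation as an infimum over competitors, and its uniform approximation *)

Section Relaxation.
Context {R : realType}.
Variable Omega : set (plane R).
Hypothesis hOmega : rational_polygon Omega.
Variable P : set (plane R).
Implicit Types (x y z : plane R) (t d c r : R) (m : lattice).
Implicit Types (G : plane R -> R) (Q : set (plane R)).

Local Notation adm := (admissible Omega P).
Local Notation F := (tropical_relaxation Omega P).

Lemma relaxation_le G x : adm G -> Omega x -> F x <= G x.
Proof.
move=> aG Ox; apply: ge_inf; last by exists G.
by exists 0 => _ [H [[_ H0 _ _] _] <-]; exact: H0.
Qed.

Hypothesis adm0 : exists G, adm G.

Lemma relaxation_ge x r : (forall G, adm G -> r <= G x) -> r <= F x.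
Proof.
move=> h; apply: lb_le_inf; last by move=> _ [H aH <-]; exact: h.
by have [G aG] := adm0; exists (G x), G.
Qed.

Lemma relaxation_lt x r : F x < r -> exists2 G, adm G & G x < r.
Proof.
move=> Fr; apply: contrapT => h; move: Fr; rewrite ltNge => /negP; apply.
apply: relaxation_ge => G aG; rewrite leNgt; apply/negP => Gr.
by apply: h; exists G.
Qed.

Lemma relaxation_ge0 x : Omega x -> 0 <= F x.
Proof. by move=> Ox; apply: relaxation_ge => G [[_ G0 _ _] _]; exact: G0. Qed.

Lemma relaxation_concave x y t : Omega° x -> Omega y -> 0 <= t <= 1 ->
  (1 - t) * F x + t * F y <= F (seg x y t).
Proof.
move=> Ox Oy t01; apply: relaxation_ge => G aG.
apply: le_trans (tropical_concave hOmega aG.1 Ox Oy t01).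
move: t01 => /andP[t0 t1].
by rewrite lerD// ler_wpM2l ?subr_ge0// relaxation_le//; exact: interior_subset.
Qed.

Lemma relaxation_le_aff x y m c : Omega° x -> Omega y -> F x = aff m c x ->
  (\forall z \near x, F z <= aff m c z) -> F y <= aff m c y.
Proof.
move=> Ox Oy Fx Fle; apply: (concave_le_aff Fx Fle) => t.
exact: relaxation_concave.
Qed.

(* By compactness, applied with the filter generated by the tails of the
   downward directed family of competitors, together with the margins d. *)
Lemma uniform_competitor Q m c : closed Q ->
  (forall x, Omega x -> aff m c x <= F x ->
     [/\ Omega° x, ~ Q x & 0 < aff m c x]) ->
  exists G0 d0, [/\ adm G0, 0 < d0 &
    forall G d, adm G -> (forall x, Omega x -> G x <= G0 x) -> 0 < d <= d0 ->
      forall x, Omega x -> G x < aff m c x - d \/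
        [/\ Omega° x, ~ Q x & d < aff m c x]].
Proof.
move=> cQ contact.
pose tail G0 d0 : set ((plane R -> R) * R) := [set Gd |
  [/\ adm Gd.1, (forall x, Omega x -> Gd.1 x <= G0 x) & 0 < Gd.2 <= d0]].
pose Fil : set_system ((plane R -> R) * R) :=
  [set S | exists G0 d0, [/\ adm G0, 0 < d0 & tail G0 d0 `<=` S]].
have FilF : Filter Fil.
  split.
  - by have [G0 a0] := adm0; exists G0, 1.
  - move=> S T [G1 [d1 [a1 p1 h1]]] [G2 [d2 [a2 p2 h2]]].
    exists (fun y => Num.min (G1 y) (G2 y)), (Num.min d1 d2); split.
    + exact: admissible_min.
    + by rewrite lt_min p1.
    + move=> [G d] [/= aG hG]; rewrite le_min => /and3P[dp dd1 dd2]; split.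
        apply: h1; split => //=; rewrite ?dp// => x /hG.
        by rewrite le_min => /andP[].
      apply: h2; split => //=; rewrite ?dp// => x /hG.
      by rewrite le_min => /andP[].
  - move=> S T ST [G1 [d1 [a1 p1 h1]]]; exists G1, d1; split => //.
    exact: subset_trans h1 ST.
pose good (Gd : (plane R -> R) * R) x := Gd.1 x < aff m c x - Gd.2 \/
  [/\ Omega° x, ~ Q x & Gd.2 < aff m c x].
have cO : near_covering_within Omega.
  by apply/near_covering_withinP/compact_near_coveringP/polygon_compact.
have [|G0 [d0 [a0 p0 h0]]] := cO _ Fil good FilF.
  (* Off the contact set some competitor lies below the affine function by twice the margin [d], and
     one margin survives near [x] by continuity; on the contact set the three conditions are
     open. *)
  move=> x Ox; case: (ltP (F x) (aff m c x)) => [Flt|/(contact _ Ox)].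
    have [G aG Gx] := relaxation_lt Flt.
    pose d := (aff m c x - G x) / 2.
    have d0 : 0 < d by rewrite divr_gt0// subr_gt0.
    have nG : \forall y \near x, Omega y -> G y < aff m c y - d.
      have [[/subspace_continuousP cG _ _ _] _] := aG.
      have Gd : G x < aff m c x - d by rewrite /d; lra.
      have cl : aff m c y - d @[y --> within Omega (nbhs x)] --> aff m c x - d.
        apply: cvg_within_filter; apply: cvgB; last exact: cvg_cst.
        exact: aff_continuous.
      exact: near_lt (cG x Ox) cl Gd.
    exists ([set y | Omega y -> G y < aff m c y - d], tail G d).
      split; first exact: nG.
      by exists G, d; split => // ?.
    move=> [y [H e]] [/= /[swap] -[/= aH HG /andP[e0 ed]] yG Oy]; left => /=.
    by apply: (le_lt_trans (HG _ Oy)); apply: (lt_le_trans (yG Oy)); rewrite lerB.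
  move=> [Oix nQx lx].
  pose d := aff m c x / 2.
  have d0 : 0 < d by rewrite divr_gt0.
  have [G aG] := adm0.
  exists ([set y | [/\ Omega° y, ~ Q y & d < aff m c y]], tail G d).
    split; last by exists G, d; split => // ?.
    change (\forall y \near x, [/\ Omega° y, ~ Q y & d < aff m c y]).
    near=> y; split.
    - by near: y; exact: nbhs_interior.
    - by near: y; apply: open_nbhs_nbhs; split; [exact: closed_openC|].
    - near: y; apply: (cvgr_gt _ (@aff_continuous R m c x)).
      by rewrite /d ltr_pdivrMr// ltr_pMr// ltr1n.
  move=> [y [H e]] [/= /[swap] -[/= aH HG /andP[e0 ed]] [yO yQ yl] Oy]; right.
  by split => //=; exact: le_lt_trans yl.
exists G0, d0; split => // G d aG GG0 dd x Ox.
by apply: (h0 (G, d)).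
Unshelve. all: by end_near. Qed.

End Relaxation.

(** * Inserting an affine term into a competitor *)

Section Insertion.
Context {R : realType}.
Variable Omega : set (plane R).
Hypothesis hOmega : rational_polygon Omega.
Implicit Types (x y z : plane R) (t d c r : R) (m : lattice).
Implicit Types (G : plane R -> R) (P Q : set (plane R)).

(** Where the lowered term can undercut [G], the point is interior, outside [Q], and the term is
    positive; elsewhere [G'] agrees with [G]. Hence boundary values, sign and the corners at [Q]
    survive. *)
Lemma tropical_insert Q G m c d : tropical_series Omega G ->
  (forall x, Omega x -> G x < aff m c x - d \/
    [/\ Omega° x, ~ Q x & d < aff m c x]) ->
  let G' := fun y => Num.min (G y) (aff m (c - d) y) in
  tropical_series Omega G' /\
  forall x, Q x -> corner_locus Omega G x -> corner_locus Omega G' x.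
Proof.
move=> sG good /=.
have affB x : aff m (c - d) x = aff m c x - d by rewrite /aff addrAC.
split.
  apply: (tropical_series_min sG).
  - by apply: continuous_subspaceT; exact: aff_continuous.
  - by move=> x _; do 2 eexists; exact: local_form_aff.
  - move=> x Ox; rewrite affB.
    case: (good x Ox) => [/ltW|[Oix _ dx]]; first by left.
    by right; split; rewrite // subr_ge0 ltW.
move=> x Qx Gx; apply: (corner_minl Gx); first exact: local_form_aff.
rewrite affB; case: (good x) => [|/ltW//|[]//].
by case: Gx => /interior_subset.
Qed.

(** The lowered term lies strictly below [aff m c], and inserting it leaves the corners at [P]
    intact, so the result is still a competitor. *)
Lemma relaxation_insert P m c : (exists G, admissible Omega P G) -> closed P ->
  (forall x, Omega x -> aff m c x <= tropical_relaxation Omega P x ->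
     [/\ Omega° x, ~ P x & 0 < aff m c x]) ->
  forall x, Omega x -> tropical_relaxation Omega P x < aff m c x.
Proof.
move=> adm0 cP contact x Ox.
have [G [d [[sG kG] d0 good]]] := uniform_competitor hOmega adm0 cP contact.
have [|s' k'] := @tropical_insert P G m c d sG.
  by move=> y Oy; apply: (good G d) => //; rewrite d0 lexx.
apply: (@le_lt_trans _ _ (Num.min (G x) (aff m (c - d) x))).
  apply: (@relaxation_le _ _ P (fun y => Num.min (G y) (aff m (c - d) y))) => //.
  by split => // y Py; apply: k' => //; exact: kG.
by rewrite gt_min /aff ltrD2r ltrBlDr ltrDl d0 orbT.
Qed.

(* The inserted term is lowered until its graph passes through that of the
   competitor above the new point q, which creates a corner there. *)
Lemma relaxation_move P Q m c p : (exists G, admissible Omega P G) ->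
  closed Q -> Q `<=` P ->
  (forall x, Omega x -> aff m c x <= tropical_relaxation Omega P x ->
     [/\ Omega° x, ~ Q x & 0 < aff m c x]) ->
  Omega p -> aff m c p <= tropical_relaxation Omega P p ->
  exists2 d0, 0 < d0 & forall q P', Omega° q -> P' `<=` Q `|` [set q] ->
    tropical_relaxation Omega P q < aff m c q ->
    aff m c q - tropical_relaxation Omega P q <= d0 ->
    forall x, Omega x ->
      tropical_relaxation Omega P' x <= tropical_relaxation Omega P x.
Proof.
move=> adm0 cQ QP contact Op lp.
have [G0 [d0 [aG0 d00 good]]] := uniform_competitor hOmega adm0 cQ contact.
exists d0 => // q P' Oq P'Q qlt qle x Ox.
have Oq' := interior_subset Oq.
apply: (relaxation_ge adm0) => G1 aG1.
have [G2 aG2 G2q] := relaxation_lt adm0 qlt.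
(* [G0] validates every margin up to [d0], [G1] is the arbitrary competitor to be compared with, and
   [G2] makes the gap at [q] positive. *)
pose G y := Num.min (G0 y) (Num.min (G1 y) (G2 y)).
have aG : admissible Omega P G.
  exact: (admissible_min aG0 (admissible_min aG1 aG2)).
have GG0 y : G y <= G0 y by rewrite ge_min lexx.
have GG1 y : G y <= G1 y by rewrite !ge_min lexx !orbT.
have GG2 y : G y <= G2 y by rewrite !ge_min lexx !orbT.
have [sG kG] := aG.
pose d := aff m c q - G q.
have d_gt0 : 0 < d by rewrite subr_gt0 (le_lt_trans (GG2 q)).
have d_le : d <= d0.
  by apply: le_trans qle; rewrite lerD2l lerN2; exact: relaxation_le.
have [|s' k'] := @tropical_insert Q G m c d sG.
  by apply: good => //; rewrite d_gt0.
have aq : aff m (c - d) q = G q by rewrite /aff addrAC /d opprB addrCA subrr addr0.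
apply: (@le_trans _ _ (Num.min (G x) (aff m (c - d) x))); last first.
  by rewrite ge_min GG1.
apply: (@relaxation_le _ _ P' (fun y => Num.min (G y) (aff m (c - d) y))) => //.
split => // y /P'Q[Qy|->{y}].
  by apply: k' => //; apply: kG; exact: QP.
have [_ _ _ /(_ _ Oq)[A [c1 lf]]] := sG.
have [[m1 Am1 Gq] _] := nbhs_singleton lf.2.
(* If the term of [G] active at [q] had gradient [m], it would be [aff m (c - d)], a majorant of [G]
   by concavity; at [p] this puts [G] strictly below [aff m c], hence below the relaxation. *)
have m1m : m1 != m.
  apply/eqP => m1m; subst m1.
  have c1m : c1 m = c - d.
    by move: Gq; rewrite -aq /aff => /addIr.
  have Gle : \forall z \near q, G z <= aff m (c - d) z.
    by case: lf => _; apply: filterS => z [_ /(_ _ Am1)]; rewrite c1m.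
  have := tropical_le_aff hOmega sG Oq Op (esym aq) Gle.
  apply/negP; rewrite -ltNge; apply: (@lt_le_trans _ _ (aff m c p)).
    by rewrite /aff ltrD2r ltrBlDr ltrDl.
  by apply: le_trans lp _; exact: relaxation_le.
apply: (corner_min Oq lf (local_form_aff m (c - d) q) m1m) => m' [->|->].
  by left; split => //; rewrite -Gq aq minxx.
by right; split => //; rewrite -/(aff m (c - d) q) aq minxx.
Qed.

End Insertion.

(** * Supergradients at interior points, and the dual polygons of vertices *)

Section Vertex.
Context {R : realType}.
Variable Omega : set (plane R).
Hypothesis hOmega : rational_polygon Omega.
Implicit Types (x y z u v : plane R) (t d c r : R) (m : lattice).
Implicit Types (F : plane R -> R) (P Q : set (plane R)).

Lemma near_step x u (Q : set (plane R)) : (\forall z \near x, Q z) ->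
  exists2 r, 0 < r & forall t, `|t| < r -> Q (x + t *: u).
Proof.
move=> Qx; have H0 : \forall z \near x + (0 : R) *: u, Q z.
  by rewrite scale0r addr0.
have lc : continuous (fun t : R => x + t *: u).
  move=> t; apply: cvgD; first exact: cvg_cst.
  by apply: cvgZr_tmp; exact: cvg_id.
have H : \forall t \near (0 : R), Q (x + t *: u) := lc _ _ H0.
have [r /= r0 rQ] := (nbhs_ballP _ _).1 H.
by exists r => // t tr; apply: rQ; rewrite /ball/= sub0r normrN.
Qed.

Lemma pairing_step p u v t :
  pairing p (v + t *: u) = pairing p v + t * pairing p u :> R.
Proof.
rewrite /pairing -[(_ + _).1]/(v.1 + t * u.1) -[(_ + _).2]/(v.2 + t * u.2).
by ring.
Qed.

Lemma pairing_sub p u v : pairing p (u - v) = pairing p u - pairing p v :> R.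
Proof.
rewrite /pairing -[(_ - _).1]/(u.1 - v.1) -[(_ - _).2]/(u.2 - v.2).
by ring.
Qed.

Lemma pairingC u v : pairing u v = pairing v u :> R.
Proof. by rewrite /pairing (mulrC u.1) (mulrC u.2). Qed.

Lemma pairing_self_eq0 u : (pairing u u <= 0) = (u == 0) :> bool.
Proof.
apply/idP/eqP => [|->]; last by rewrite /pairing /= mulr0 addr0.
case: u => a b; rewrite /pairing/= => ab.
have a2 := sqr_ge0 a; have b2 := sqr_ge0 b.
have : a ^+ 2 = 0 /\ b ^+ 2 = 0 by move: a2 b2 ab; rewrite !expr2; split; lra.
by move=> [/eqP + /eqP]; rewrite !sqrf_eq0 => /eqP -> /eqP ->.
Qed.

Lemma zvec_inj : injective (@zvec R).
Proof. by move=> [a b] [a' b'] [/intr_inj -> /intr_inj ->]. Qed.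

(** A short step from [x] in the direction [- u] lowers the value by a positive multiple of
    [pairing u u], which must then vanish. *)
Lemma touching_gradient0 u c x :
  (\forall y \near x, 0 <= c + pairing u y) -> c + pairing u x <= 0 -> u = 0.
Proof.
move=> /(near_step u)[r r0 h] ux.
have r2 : `|- (r / 2)| < r.
  by rewrite normrN gtr0_norm ?divr_gt0// ltr_pdivrMr// ltr_pMr// ltr1n.
have := h _ r2; rewrite pairing_step addrA => h'.
apply/eqP; rewrite -pairing_self_eq0.
have : 0 <= - (r / 2 * pairing u u).
  by rewrite -mulNr; move: h' ux; move: (c + _) => w; lra.
by rewrite oppr_ge0 pmulr_rle0// divr_gt0.
Qed.

Lemma aff_touching m c x : (\forall y \near x, 0 <= aff m c y) ->
  aff m c x <= 0 -> m = 0.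
Proof. by move=> h /(touching_gradient0 h) zm; apply: zvec_inj. Qed.

Lemma superdifferential_zero F x u : Omega° x ->
  (forall y, Omega y -> 0 <= F y) -> F x <= 0 ->
  superdifferential Omega F x u -> u = 0.
Proof.
move=> /(near_step u)[r r0 h] F0 Fx du.
have r2 : `|- (r / 2)| < r.
  by rewrite normrN gtr0_norm ?divr_gt0// ltr_pdivrMr// ltr_pMr// ltr1n.
have := le_trans (F0 _ (h _ r2)) (du _ (h _ r2)).
rewrite pairing_sub pairing_step => h'.
apply/eqP; rewrite -pairing_self_eq0.
have : 0 <= - (r / 2 * pairing u u).
  by rewrite -mulNr; move: h' Fx; move: (F x) => w; lra.
by rewrite oppr_ge0 pmulr_rle0// divr_gt0.
Qed.

(** With no competitor, the infimum of the empty set is [0] by convention; the relaxation then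
    vanishes identically, every active term at [x] has gradient [0], and no two of them are
    distinct. *)
Lemma admissible_exists P x : corner_locus Omega (tropical_relaxation Omega P) x ->
  exists G, admissible Omega P G.
Proof.
move=> [Ox [A [c [lf [m0 [m1 [A0 A1 m01 e0 e1]]]]]]].
apply: contrapT => noG.
have F0 y : tropical_relaxation Omega P y = 0.
  rewrite /tropical_relaxation (_ : image _ _ = set0) ?inf0//.
  by rewrite -subset0 => z [G aG _]; apply: noG; exists G.
have act m : A m -> tropical_relaxation Omega P x = c m + pairing (zvec m) x ->
    m = 0.
  move=> Am; rewrite F0 => em; apply: (@aff_touching _ (c m) x).
    by case: lf => _; apply: filterS => y [_ /(_ _ Am)]; rewrite F0.
  by rewrite /aff -em.
by move: m01; rewrite (act _ A0 e0) (act _ A1 e1) eqxx.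
Qed.

Lemma vertex_no_interior_lattice_point P v m :
  (exists G, admissible Omega P G) -> closed P -> ~ P v ->
  graph_vertex Omega (tropical_relaxation Omega P) v ->
  ~ (superdifferential Omega (tropical_relaxation Omega P) v)° (zvec m).
Proof.
set F := tropical_relaxation _ _ => adm0 cP Pv [Ov dim2] intm.
pose c := F v - pairing (zvec m) v.
have Fv : aff m c v = F v by rewrite /aff subrK.
suff : F v < aff m c v by rewrite Fv ltxx.
apply: relaxation_insert => //; last exact: interior_subset.
move=> x Ox; rewrite -/F => mx.
have -> : x = v.
  apply/eqP; rewrite -subr_eq0 -pairing_self_eq0.
  (* Moving from [zvec m] by a small negative multiple of [x - v] stays in the superdifferential;
     tested at [x] itself, this contradicts contact unless [x = v]. *)
  have [r r0 h] := near_step (x - v) intm.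
  have r2 : `|- (r / 2)| < r.
    by rewrite normrN gtr0_norm ?divr_gt0// ltr_pdivrMr// ltr_pMr// ltr1n.
  have := h _ r2 _ Ox; rewrite [pairing (_ + _) _]pairingC pairing_step.
  rewrite pairingC pairing_sub => h'.
  have : 0 <= - (r / 2 * pairing (x - v) (x - v)).
    by rewrite -mulNr; move: h' mx; rewrite /aff /c; move: (F v) (F x) => ? ?; lra.
  by rewrite oppr_ge0 pmulr_rle0// divr_gt0.
(* If [F v <= 0], then [0] is the only possible supergradient at [v], and the superdifferential is
   not two-dimensional. *)
split => //; rewrite Fv ltNge; apply/negP => Fv0.
have sd0 := superdifferential_zero Ov (relaxation_ge0 adm0) Fv0.
have [p [q [r [/sd0 -> /sd0 -> /sd0 -> ]]]] := dim2.
by rewrite subrr /det2/= !mul0r subrr eqxx.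
Qed.

End Vertex.

(** * Wedges, where two affine terms meet *)

Section Wedge.
Context {R : realType}.
Implicit Types (x y z u v w : plane R) (t d c r : R) (m : lattice).
Implicit Types (F : plane R -> R) (P Q : set (plane R)).

Lemma near_near x (Q : set (plane R)) : (\forall z \near x, Q z) ->
  \forall y \near x, \forall z \near y, Q z.
Proof. exact: nbhs_interior. Qed.

Lemma near_singleton x (Q : set (plane R)) : (\forall z \near x, Q z) -> Q x.
Proof. exact: nbhs_singleton. Qed.

Lemma near_aff_lt m c m' c' x : aff m c x < aff m' c' x ->
  \forall y \near x, aff m c y < aff m' c' y.
Proof.
move=> lt.
exact: (near_lt (@aff_continuous R m c x) (@aff_continuous R m' c' x) lt).
Qed.

Lemma near_affine_eq u c v c' x :
  (\forall y \near x, c + pairing u y = c' + pairing v y) -> u = v /\ c = c'.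
Proof.
move=> h; suff uv : u = v.
  by split => //; have := near_singleton h; rewrite uv => /addIr.
have e y : (c - c') + pairing (u - v) y = (c + pairing u y) - (c' + pairing v y).
  by rewrite pairingC pairing_sub !(pairingC y); ring.
apply/eqP; rewrite -subr_eq0; apply/eqP; apply: (@touching_gradient0 _ _ (c - c') x).
  by apply: filterS h => y hy; rewrite e hy subrr.
by rewrite e (near_singleton h) subrr.
Qed.

Lemma near_aff_eq m c m' c' x :
  (\forall y \near x, aff m c y = aff m' c' y) -> m = m' /\ c = c'.
Proof. by move=> /near_affine_eq[/zvec_inj]. Qed.

(** Otherwise the difference of the two functions would be nonnegative near [y] and zero at [y],
    which forces equal gradients. *)
Lemma aff_lt_side m0 c0 m1 c1 y (Q : set (plane R)) : m0 != m1 ->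
  aff m0 c0 y = aff m1 c1 y -> (\forall z \near y, Q z) ->
  exists2 z, Q z & aff m0 c0 z < aff m1 c1 z.
Proof.
move=> m01 e Qy; apply: contrapT => h.
suff : (zvec m0 : plane R) = zvec m1 by move=> /zvec_inj; apply/eqP.
have e' z : (c0 - c1) + pairing (zvec m0 - zvec m1) z = aff m0 c0 z - aff m1 c1 z.
  by rewrite /aff pairingC pairing_sub !(pairingC z); ring.
apply/eqP; rewrite -subr_eq0; apply/eqP.
apply: (@touching_gradient0 _ _ (c0 - c1) y); last by rewrite e' e subrr.
apply: filterS Qy => z Qz; rewrite e' subr_ge0 leNgt; apply/negP => lt.
by apply: h; exists z.
Qed.

(** Where one term is strictly smaller, the minimum is locally that term, and affine functions
    agreeing near a point coincide. At a tie with distinct gradients, [aff_lt_side] moves to a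
    nearby point of strict inequality. *)
Lemma aff_eq_min m c m0 c0 m1 c1 x :
  (\forall y \near x, aff m c y = Num.min (aff m0 c0 y) (aff m1 c1 y)) ->
  (m = m0 /\ c = c0) \/ (m = m1 /\ c = c1).
Proof.
move=> h.
have left_case y :
    (\forall y \near y, aff m c y = Num.min (aff m0 c0 y) (aff m1 c1 y)) ->
    aff m0 c0 y < aff m1 c1 y -> (m = m0 /\ c = c0) \/ (m = m1 /\ c = c1).
  move=> {}h lt; left; apply: (@near_aff_eq _ _ _ _ y).
  near=> z; have -> : aff m c z = Num.min (aff m0 c0 z) (aff m1 c1 z).
    by near: z.
  apply/min_idPl/ltW; near: z; exact: near_aff_lt.
case: (ltgtP (aff m0 c0 x) (aff m1 c1 x)) => [|lt|e]; first exact: left_case.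
  right; apply: (@near_aff_eq _ _ _ _ x).
  near=> z; have -> : aff m c z = Num.min (aff m0 c0 z) (aff m1 c1 z).
    by near: z.
  apply/min_idPr/ltW; near: z; exact: near_aff_lt.
have [m01|m01] := eqVneq m0 m1.
  have c01 : c0 = c1 by move: e; rewrite m01 => /addIr.
  left; apply: (@near_aff_eq _ _ _ _ x).
  by apply: filterS h => z ->; rewrite m01 c01 minxx.
have [z hz lt] := aff_lt_side m01 e (near_near h).
exact: left_case hz lt.
Unshelve. all: by end_near. Qed.

(** The local picture in the relative interior of an edge: by [plain_wedge] and [wedge_plain] it
    characterises the corner points of the relaxation that are not vertices. *)
Definition wedge F m0 c0 m1 c1 x : Prop :=
  [/\ m0 != m1, aff m0 c0 x = aff m1 c1 x
    & \forall y \near x, F y = Num.min (aff m0 c0 y) (aff m1 c1 y)].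

Lemma wedge_sym F m0 c0 m1 c1 x : wedge F m0 c0 m1 c1 x -> wedge F m1 c1 m0 c0 x.
Proof.
move=> [m01 e h]; split; [by rewrite eq_sym|by []|].
by apply: filterS h => y ->; rewrite minC.
Qed.

Lemma wedge_value F m0 c0 m1 c1 x : wedge F m0 c0 m1 c1 x -> F x = aff m0 c0 x.
Proof. by move=> [_ e /near_singleton ->]; rewrite -e minxx. Qed.

Lemma wedge_aff F m c m0 c0 m1 c1 x (U : set (plane R)) :
  wedge F m0 c0 m1 c1 x -> open U -> closure U x ->
  (forall y, U y -> F y = aff m c y) -> (m = m0 /\ c = c0) \/ (m = m1 /\ c = c1).
Proof.
move=> [_ _ h] oU cU FU.
have [z [Uz nz]] := cU _ (near_near h).
apply: (@aff_eq_min _ _ _ _ _ _ z); near=> y.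
have Uy : U y by near: y; exact: open_nbhs_nbhs.
by rewrite -FU//; near: y.
Unshelve. all: by end_near. Qed.

End Wedge.

(** * Corner points that are not vertices *)

Section LocalStructure.
Context {R : realType}.
Implicit Types (x y z u v w : plane R) (t d c r : R) (m : lattice).

(** Binet-Cauchy: the difference of the two sides is [det2 u w * det2 u v]. *)
Lemma det2_decomp u w v :
  det2 u w = 0 -> pairing u u * pairing w v = pairing u w * pairing u v :> R.
Proof.
rewrite /det2 /pairing => h; apply/eqP; rewrite -subr_eq0; apply/eqP.
transitivity ((u.1 * w.2 - u.2 * w.1) * (u.1 * v.2 - u.2 * v.1)); first by ring.
by rewrite h mul0r.
Qed.

Lemma det2_parallel u w w' : u != 0 ->
  det2 u w = 0 -> det2 u w' = 0 -> det2 w w' = 0 :> R.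
Proof.
move=> u0 h h'; have uu : pairing u u != 0 :> R.
  by apply: contra u0; rewrite -pairing_self_eq0 => /eqP ->.
apply: (mulfI uu); rewrite mulr0.
transitivity (pairing u w * det2 u w' - det2 u w * pairing u w').
  by rewrite /det2 /pairing; ring.
by rewrite h h' mulr0 mul0r subrr.
Qed.

Lemma det2_subr u v w : det2 u (v - w) = det2 u v - det2 u w :> R.
Proof.
rewrite /det2 -[(v - w).1]/(v.1 - w.1) -[(v - w).2]/(v.2 - w.2); ring.
Qed.

Lemma finite_argmin (T : eqType) (A : set T) (f : T -> R) : finite_set A ->
  A !=set0 -> exists2 a, A a & forall b, A b -> f a <= f b.
Proof.
move=> /finite_seqP[s ->] [a0 a0s]; have : s != [::] by case: s a0s.
elim: s {a0 a0s} => // a [|a' s] IH _.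
  by exists a => [|b]/=; rewrite ?inE// => /eqP ->.
have [//|b bs hb] := IH; case: (leP (f a) (f b)) => ab.
  exists a; rewrite /= ?inE ?eqxx// => e /=; rewrite inE => /orP[/eqP ->//|/hb].
  exact: le_trans.
exists b; rewrite /= ?inE; first by move: bs; rewrite /= inE => ->; rewrite orbT.
by move=> e /=; rewrite inE => /orP[/eqP ->|/hb//]; exact: ltW.
Qed.

Lemma near_finite (T : eqType) (A : set T) (Q : T -> set (plane R)) x :
  finite_set A -> (forall a, A a -> \forall y \near x, Q a y) ->
  \forall y \near x, forall a, A a -> Q a y.
Proof.
move=> /finite_seqP[s ->]; elim: s => [_|a s IH h].
  by near=> y.
have h1 : \forall y \near x, forall b, [set` s] b -> Q b y.
  by apply: IH => b /= bs; apply: h; rewrite /= inE bs orbT.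
have h2 : \forall y \near x, Q a y by apply: h; rewrite /= inE eqxx.
near=> y => b; rewrite /= inE => /orP[/eqP ->|]; first by near: y.
by move: b; near: y.
Unshelve. all: by end_near. Qed.

Variable Omega : set (plane R).
Hypothesis hOmega : rational_polygon Omega.
Variable P : set (plane R).
Hypothesis adm0 : exists G, admissible Omega P G.

Local Notation F := (tropical_relaxation Omega P).
Local Notation wedge := (wedge F).
Local Notation plain := (corner_locus Omega F `\` graph_vertex Omega F).

Lemma superdifferential_touching x m c : Omega° x -> F x = aff m c x ->
  (\forall y \near x, F y <= aff m c y) -> superdifferential Omega F x (zvec m).
Proof.
move=> Ox Fx Fle y Oy.
have := relaxation_le_aff hOmega adm0 Ox Oy Fx Fle.
by rewrite Fx pairing_sub /aff => h; apply: (le_trans h); lra.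
Qed.

(** Active gradients at [x] are supergradients, hence collinear when [x] is not a vertex. Near [x]
    the minimum over them is attained by the two extreme ones along [u], namely [a] and [b], while
    inactive terms stay strictly above [F]. *)
Lemma plain_wedge x : plain x -> exists m0 c0 m1 c1, wedge m0 c0 m1 c1 x.
Proof.
move=> [[Ox [A [c [[fA lf] [m0 [m1 [A0 A1 m01 e0 e1]]]]]]] nv].
pose B := [set m | A m /\ F x = aff m (c m) x].
have B0 : B m0 by split.
have B1 : B m1 by split.
have fB : finite_set B by apply: sub_finite_set fA => m [].
pose u : plane R := zvec m1 - zvec m0.
have u0 : u != 0.
  by rewrite subr_eq0; apply: contra m01 => /eqP /zvec_inj ->.
have Fle m : A m -> \forall y \near x, F y <= aff m (c m) y.
  by move=> Am; apply: filterS lf => y [_ /(_ _ Am)].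
have Bsd m : B m -> superdifferential Omega F x (zvec m).
  by move=> [Am Fx]; apply: (superdifferential_touching Ox Fx); exact: Fle.
have Bcol m : B m -> det2 u (zvec m - zvec m0) = 0.
  move=> Bm; apply: contrapT => /eqP hd; apply: nv; split => //.
  by exists (zvec m0), (zvec m1), (zvec m); split => //; exact: Bsd.
have Bval m v : B m -> pairing u u * (pairing (zvec m) v - pairing (zvec m0) v) =
    (pairing u (zvec m) - pairing u (zvec m0)) * pairing u v.
  move=> /Bcol /(@det2_decomp _ _ v); rewrite pairing_sub.
  by rewrite pairingC pairing_sub !(pairingC v).
have uu : 0 < pairing u u by rewrite ltNge pairing_self_eq0.
have [a Ba ha] :=
  @finite_argmin _ B (fun m => pairing u (zvec m)) fB (ex_intro _ _ B0).
have [b Bb hb] :=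
  @finite_argmin _ B (fun m => - pairing u (zvec m)) fB (ex_intro _ _ B0).
have ab : a != b.
  apply/eqP => ab; subst b.
  have h : pairing u (zvec m1) <= pairing u (zvec m0).
    by rewrite -lerN2; apply: le_trans (hb _ B1); rewrite lerN2 ha.
  by move: uu; rewrite {2}/u pairing_sub subr_gt0 ltNge h.
exists a, (c a), b, (c b); split => //.
  by rewrite -(proj2 Ba) -(proj2 Bb).
have inB : \forall y \near x, forall m, A m -> B m \/ F y < aff m (c m) y.
  apply: near_finite => // m Am.
  case: (pselect (F x = aff m (c m) x)) => Fm.
    by near=> y; left.
  have lt : aff m0 (c m0) x < aff m (c m) x.
    rewrite -[X in X < _]e0 lt_neqAle; apply/andP; split; first exact/eqP.
    exact: (near_singleton (Fle _ Am)).
  near=> y; right; apply: (@le_lt_trans _ _ (aff m0 (c m0) y)).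
    by near: y; exact: Fle.
  by near: y; exact: near_aff_lt.
near=> y; apply/eqP; rewrite eq_le le_min -andbA; apply/and3P; split.
- by near: y; apply: Fle; case: Ba.
- by near: y; apply: Fle; case: Bb.
have [[m Am Fy] _] : is_tropical_min A c y (F y) by near: y.
have Bm : B m.
  have [//|] : B m \/ F y < aff m (c m) y by move: (m) Am; near: y.
  by rewrite Fy ltxx.
have shift k : B k -> aff k (c k) y = F x + pairing (zvec k) (y - x).
  by move=> [_ ->]; rewrite pairing_sub /aff; ring.
(* By [Bval], comparing two active terms at [y] reduces to the sign of a product: the difference of
   their gradients along [u] times the position of [y] along [u]. *)
have cmp k k' : B k -> B k' ->
   (pairing u (zvec k) - pairing u (zvec k')) * pairing u (y - x) <= 0 ->
   aff k (c k) y <= aff k' (c k') y.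
  move=> Bk Bk' h; rewrite !shift// lerD2l -(ler_pM2l uu).
  have h1 := Bval k (y - x) Bk; have h2 := Bval k' (y - x) Bk'.
  by move: h1 h2 h; rewrite !mulrBl !mulrBr; lra.
rewrite Fy -/(aff m (c m) y) ge_min; case: (lerP 0 (pairing u (y - x))) => s.
  by rewrite cmp// mulr_le0_ge0// subr_le0 ha.
apply/orP; right; apply: cmp => //; apply: mulr_ge0_le0; last exact: ltW.
by rewrite subr_ge0 -lerN2 hb.
Unshelve. all: by end_near. Qed.

(** Along the direction [v] orthogonal to [zvec m1 - zvec m0] both terms agree, so [F] is affine on
    a short segment through [x]. This fixes [pairing k v] for every supergradient [k] and confines
    the superdifferential to a line. *)
Lemma wedge_plain x m0 c0 m1 c1 : Omega° x -> wedge m0 c0 m1 c1 x -> plain x.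
Proof.
move=> Ox W; have [m01 e h] := W.
have m10 : (m1 == m0) = false by rewrite eq_sym (negbTE m01).
split.
  split => //; exists [set m0; m1], (fun m => if m == m0 then c0 else c1).
  split; last first.
    exists m0, m1; rewrite eqxx m10.
    by split; [left|right| |exact: wedge_value W|rewrite (wedge_value W)].
  split; first by rewrite finite_setU; split; exact: finite_set1.
  apply: filterS h => y ->; split; last first.
    by move=> m [|] -> /=; rewrite ?eqxx ?m10 ge_min lexx ?orbT.
  case: (leP (aff m0 c0 y) (aff m1 c1 y)) => _.
    by exists m0; [left|rewrite eqxx].
  by exists m1; [right|rewrite m10].
move=> [_ [p [q [r [sp sq sr]]]]]; apply/negP; rewrite negbK; apply/eqP.
pose u : plane R := zvec m1 - zvec m0.
have u0 : u != 0.
  by rewrite subr_eq0; apply: contra m01 => /eqP /zvec_inj ->.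
have col k : superdifferential Omega F x k -> det2 u (k - zvec m0) = 0.
  move=> sk; pose v : plane R := (- u.2, u.1).
  have uv : pairing (zvec m1) v = pairing (zvec m0) v.
    apply/eqP; rewrite -subr_eq0 -!(pairingC v) -pairing_sub /pairing /=.
    by apply/eqP; ring.
  have h' : \forall y \near x, Omega y /\ F y = Num.min (aff m0 c0 y) (aff m1 c1 y).
    by near=> y; split; near: y.
  have [s s0 hs] := near_step v h'.
  have step t : `|t| < s -> t * (pairing (zvec m0) v - pairing k v) <= 0.
    move=> /hs[Oy Fy]; have := sk _ Oy.
    rewrite Fy (wedge_value W) !pairing_sub !pairing_step.
    have -> : aff m1 c1 (x + t *: v) = aff m0 c0 (x + t *: v).
      by rewrite /aff !pairing_step uv !(addrA _ (pairing _ x)); congr (_ + _).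
    by rewrite minxx /aff pairing_step; lra.
  have s2 : `|s / 2| < s.
    by rewrite gtr0_norm ?divr_gt0// ltr_pdivrMr// ltr_pMr// ltr1n.
  have h1 := step _ s2; have := step (- (s / 2)); rewrite normrN => /(_ s2) h2.
  have z : pairing (zvec m0) v - pairing k v = 0.
    have s20 : 0 < s / 2 by rewrite divr_gt0.
    move: h1 h2; rewrite mulNr oppr_le0 => h1 h2.
    have : s / 2 * (pairing (zvec m0) v - pairing k v) = 0.
      by apply/eqP; rewrite eq_le h1.
    by move/eqP; rewrite mulf_eq0 gt_eqF//= => /eqP.
  rewrite det2_subr; move: z; rewrite /det2 /pairing /v /=; lra.
apply: (@det2_parallel u); rewrite // det2_subr.
  by have := col _ sp; have := col _ sq; rewrite !det2_subr; lra.
by have := col _ sp; have := col _ sr; rewrite !det2_subr; lra.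
Unshelve. all: by end_near. Qed.

End LocalStructure.

(** * Cells and edges of the subdivision *)

Section Edges.
Context {R : realType}.
Implicit Types (x y z u v w : plane R) (t d c r : R) (m : lattice).
Implicit Types (A B U e : set (plane R)).

Lemma seg_connected A x : A x ->
  (forall y t, A y -> 0 <= t <= 1 -> A (seg x y t)) -> connected A.
Proof.
move=> Ax star.
have -> : A = \bigcup_(y in A) (seg x y @` `[0, 1]).
  apply/seteqP; split => [y Ay|_ [y Ay [t + <-]]].
    by exists y => //; exists 1; rewrite ?seg1//= in_itv/= ler01 lexx.
  by rewrite /= in_itv /=; exact: star.
apply: bigcup_connected.
  by exists x => y _; exists 0; rewrite ?seg0//= in_itv/= ler01 lexx.
move=> y _; apply: connected_continuous_connected; first exact: segment_connected.
exact/continuous_subspaceT/seg_continuous.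
Qed.

Lemma connected_between (T : topologicalType) (A B : set T) :
  connected A -> A `<=` B -> B `<=` closure A -> connected B.
Proof.
move=> cA AB BA C [z Cz] [V oV CV] [D cD CD].
have AC : A `&` C = A.
  apply: cA.
  - have /BA cAz : B z by move: Cz; rewrite CV => -[].
    have Vz : V z by move: Cz; rewrite CV => -[].
    have [w [Aw Vw]] := cAz _ (open_nbhs_nbhs (conj oV Vz)).
    exists w; split => //; rewrite CV; split => //.
    exact: AB.
  - by exists V => //; rewrite CV setIA (setIidl AB).
  - by exists D => //; rewrite CD setIA (setIidl AB).
apply/seteqP; split; first by rewrite CV => ? [].
rewrite CD => y By; split => //.
apply: cD; apply: closure_subset (BA _ By) => w.
by rewrite -AC CD => -[_ []].
Qed.

Variable Omega : set (plane R).
Hypothesis hOmega : rational_polygon Omega.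
Variable P : set (plane R).
Hypothesis adm0 : exists G, admissible Omega P G.

Local Notation F := (tropical_relaxation Omega P).
Local Notation wedge := (wedge F).
Local Notation plain := (corner_locus Omega F `\` graph_vertex Omega F).

Definition flat m c : set (plane R) := [set y | Omega y /\ F y = aff m c y]°.

Lemma flat_sub m c x : flat m c x -> Omega° x /\ F x = aff m c x.
Proof.
move=> fx; split; last by have [_] := near_singleton fx.
by apply: filterS fx => y [].
Qed.

Lemma flat_le m c x y : flat m c x -> Omega y -> F y <= aff m c y.
Proof.
move=> fx Oy; have [Ox Fx] := flat_sub fx.
apply: relaxation_le_aff Ox Oy Fx _ => //.
by apply: filterS fx => z [_ ->].
Qed.

Lemma wedge_le m0 c0 m1 c1 x y : Omega° x -> wedge m0 c0 m1 c1 x -> Omega y ->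
  F y <= aff m0 c0 y.
Proof.
move=> Ox W Oy; apply: relaxation_le_aff Ox Oy (wedge_value W) _ => //.
by case: W => _ _; apply: filterS => z ->; rewrite ge_min lexx.
Qed.

(** Concavity bounds [F] below along a segment and [flat_le] bounds it above, so the set is
    star-shaped about [x], hence connected. A larger affine domain carries the same affine function
    and is thus contained in it. *)
Lemma flat_cell m c : flat m c !=set0 -> cells Omega F (flat m c).
Proof.
move=> [x fx]; split.
  split; [by exists x|exact: open_interior| | |].
  - apply: (seg_connected fx) => y t fy /andP[t0]; rewrite le_eqVlt => /orP[/eqP ->|t1].
      by rewrite seg1.
    have [Oy Fy] := flat_sub fy.
    apply: near_seg => //; have Oy' := interior_subset Oy.
    near=> w.
    have [Ow Fw] : Omega w /\ F w = aff m c w by near: w.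
    have Ow' : Omega° w by near: w; apply: near_near; exact: (flat_sub fx).1.
    have t01 : 0 <= t <= 1 by rewrite t0 ltW.
    split; first exact: polygon_seg.
    apply/eqP; rewrite eq_le (flat_le fx) ?andTb; last exact: polygon_seg.
    by have := relaxation_concave hOmega adm0 Ow' Oy' t01; rewrite Fw Fy -aff_seg.
  - by move=> y /flat_sub[].
  - by exists (zvec m), c => y /flat_sub[].
move=> U [[y Uy] oU _ UO [p [c' Up]]] fU; apply/seteqP; split => // z Uz.
have h : \forall w \near x, c' + pairing p w = c + pairing (zvec m) w.
  near=> w; have fw : flat m c w by near: w; apply: near_near; exact: fx.
  by rewrite -Up; [exact: (flat_sub fw).2|exact: fU].
have [pm cc] := near_affine_eq h.
rewrite /flat/interior /=; near=> w.
have Uw : U w by near: w; exact: open_nbhs_nbhs.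
by split; [exact: interior_subset (UO _ Uw)|rewrite Up// pm cc].
Unshelve. all: by end_near. Qed.

Lemma wedge_closure_flat m0 c0 m1 c1 x : Omega° x -> wedge m0 c0 m1 c1 x ->
  closure (flat m0 c0) x.
Proof.
move=> Ox [m01 e h] B Bx.
have h' : \forall z \near x, [/\ B z, Omega° z &
    \forall y \near z, F y = Num.min (aff m0 c0 y) (aff m1 c1 y)].
  near=> z; split; near: z; [exact: Bx|exact: near_near|exact: near_near].
have [z [Bz Oz hz] lt] := aff_lt_side m01 e h'.
exists z; split => //; rewrite /flat/interior/=; near=> y; split.
  by near: y.
have -> : F y = Num.min (aff m0 c0 y) (aff m1 c1 y) by near: y.
by apply/min_idPl/ltW; near: y; exact: near_aff_lt.
Unshelve. all: by end_near. Qed.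

Lemma closures_wedge m0 c0 m1 c1 U0 U1 x : plain x -> m0 != m1 ->
  open U0 -> open U1 -> closure U0 x -> closure U1 x ->
  (forall y, U0 y -> F y = aff m0 c0 y) ->
  (forall y, U1 y -> F y = aff m1 c1 y) -> wedge m0 c0 m1 c1 x.
Proof.
move=> px m01 o0 o1 k0 k1 F0 F1.
have [n0 [d0 [n1 [d1 W]]]] := plain_wedge hOmega adm0 px.
case: (wedge_aff W o0 k0 F0) (wedge_aff W o1 k1 F1) => [] [e0 e0'] [] [e1 e1'];
  subst=> //.
- by rewrite eqxx in m01.
- exact: wedge_sym.
- by rewrite eqxx in m01.
Qed.

Lemma edge_sub e : edges Omega F e -> e `<=` plain.
Proof. by move=> [x px <-]; exact: connected_component_sub. Qed.

Lemma edge_connected e : edges Omega F e -> connected e.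
Proof. by move=> [x px <-]; exact: component_connected. Qed.

Lemma edge_max e B x : edges Omega F e -> e x -> B x -> B `<=` plain ->
  connected B -> B `<=` e.
Proof.
move=> [x0 px0 <-] ex Bx Bp cB.
by rewrite (same_connected_component ex); exact: connected_component_max.
Qed.

(** Adjoining a limit point to a connected set keeps it connected, so the maximal component absorbs
    the point. *)
Lemma edge_closure_plain e x : edges Omega F e -> closure e x -> plain x -> e x.
Proof.
move=> He cx px; have [y ey] : e !=set0.
  by have [y [ey _]] := cx _ filterT; exists y.
apply: (edge_max (B := e `|` [set x]) He ey); [by left| | |by right].
  by move=> z [/(edge_sub He)//|->].
apply: (connected_between (edge_connected He)); first by left.
by move=> z [/subset_closure//|->].
Qed.

(** The points of [e] carrying a given wedge form an open subset, since nearby corner points can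
    only involve the same two terms, and a closed one, being those adherent to both flat regions.
    Connectedness of [e] concludes. *)
Lemma edge_wedge e : edges Omega F e -> exists m0 c0 m1 c1,
  m0 != m1 /\ forall x, e x -> wedge m0 c0 m1 c1 x.
Proof.
move=> He; have ex0 : exists x, e x.
  by case: He => x px <-; exists x; exact: connected_component_refl.
have [x0 ex0'] := ex0.
have [m0 [c0 [m1 [c1 W]]]] := plain_wedge hOmega adm0 (edge_sub He ex0').
have [m01 _ _] := W.
exists m0, c0, m1, c1; split => //.
pose B := [set x | e x /\ wedge m0 c0 m1 c1 x].
suff <- : B = e by move=> x [].
apply: (edge_connected He); first by exists x0.
- exists [set x | \forall y \near x, F y = Num.min (aff m0 c0 y) (aff m1 c1 y)].
    exact: open_interior.
  apply/seteqP; split => x [ex]; first by case.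
  move=> /= h; split => //.
  have [n0 [d0 [n1 [d1 V]]]] := plain_wedge hOmega adm0 (edge_sub He ex).
  have Ox : Omega° x by have [[]] := edge_sub He ex.
  have side n d : closure (flat n d) x ->
      (n = m0 /\ d = c0) \/ (n = m1 /\ d = c1).
    move=> cl; have [z [fz hz]] := cl _ (near_near h).
    apply: (@aff_eq_min _ _ _ _ _ _ _ z).
    near=> y; have <- : F y = Num.min (aff m0 c0 y) (aff m1 c1 y) by near: y.
    have fy : flat n d y by near: y; apply: near_near; exact: fz.
    by rewrite (flat_sub fy).2.
  have := side _ _ (wedge_closure_flat Ox (wedge_sym V)).
  have := side _ _ (wedge_closure_flat Ox V).
  have [n01 _ _] := V.
  move=> [] [e0 e0'] [] [e1 e1']; subst => //.
  + by rewrite eqxx in n01.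
  + exact: wedge_sym.
  + by rewrite eqxx in n01.
- exists (closure (flat m0 c0) `&` closure (flat m1 c1)).
    by apply: closedI; exact: closed_closure.
  apply/seteqP; split => x [ex].
    have Ox : Omega° x by have [[]] := edge_sub He ex.
    move=> V; split => //; split; first exact: wedge_closure_flat V.
    exact: wedge_closure_flat (wedge_sym V).
  move=> [k0 k1]; split => //.
  apply: (closures_wedge (edge_sub He ex) m01 _ _ k0 k1);
    [exact: open_interior|exact: open_interior| |].
  + by move=> y /flat_sub[].
  + by move=> y /flat_sub[].
Unshelve. all: by end_near. Qed.

(** By concavity the wedge at [x] persists along the half-open segment towards [y]. That segment is
    a connected set of non-vertex corner points, so it lies in [e], and [y] is a limit of it. *)
Lemma contact_closure_edge e m0 c0 m1 c1 x y : edges Omega F e ->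
  e x -> wedge m0 c0 m1 c1 x ->
  Omega y -> F y = aff m0 c0 y -> F y = aff m1 c1 y -> closure e y.
Proof.
move=> He ex W Oy F0 F1.
have Ox : Omega° x by have [[]] := edge_sub He ex.
have W1 t : 0 <= t < 1 -> wedge m0 c0 m1 c1 (seg x y t).
  move=> /andP[t0 t1]; have [m01 e01 h] := W; split => //.
    by rewrite !aff_seg e01 -F0 F1.
  apply: near_seg => //; near=> w.
  have Ow : Omega° w by near: w; exact: near_near.
  have Fw : F w = Num.min (aff m0 c0 w) (aff m1 c1 w) by near: w.
  have t01 : 0 <= t <= 1 by rewrite t0 ltW.
  have Os := polygon_seg hOmega (interior_subset Ow) Oy t01.
  apply/eqP; rewrite eq_le le_min (wedge_le Ox W Os) (wedge_le Ox (wedge_sym W) Os)/=.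
  apply: le_trans (relaxation_concave hOmega adm0 Ow Oy t01).
  rewrite Fw; case: (leP (aff m0 c0 w) (aff m1 c1 w)) => _.
    by rewrite F0 -aff_seg ge_min lexx.
  by rewrite F1 -aff_seg ge_min lexx orbT.
have st t : 0 <= t < 1 -> e (seg x y t).
  move=> t01; pose B := seg x y @` `[0, t].
  have t0 : 0 <= t by case/andP: t01.
  apply: (edge_max (B := B) He ex).
  - by exists 0; rewrite ?seg0//= in_itv /= lexx.
  - move=> _ [s + <-]; rewrite /= in_itv /= => /andP[s0 st].
    have s01 : 0 <= s < 1 by rewrite s0 (le_lt_trans st)//; case/andP: t01.
    by apply: wedge_plain (W1 _ s01); apply: polygon_seg_interior.
  - apply: connected_continuous_connected; first exact: segment_connected.
    exact/continuous_subspaceT/seg_continuous.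
  - by exists t => //; rewrite /= in_itv /= t0 lexx.
move=> B By.
have H1 : \forall z \near seg x y 1, B z by rewrite seg1.
have H : \forall t \near (1 : R), B (seg x y t) := seg_continuous H1.
have : \forall t \near (1 : R)^'-, [/\ 0 <= t, t < 1 & B (seg x y t)].
  near=> t; split.
  - by near: t; exact: nbhs_left_ge.
  - by near: t; exact: nbhs_left_lt.
  - by near: t; exact: cvg_within.
move=> /filter_ex[t [t0 t1 Bt]].
by exists (seg x y t); split => //; apply: st; rewrite t0.
Unshelve. all: by end_near. Qed.

End Edges.

(** * Interior edges of weight greater than one *)

Section EdgeContact.
Context {R : realType}.
Variable Omega : set (plane R).
Hypothesis hOmega : rational_polygon Omega.
Implicit Types (x y z u v w q : plane R) (t d c r : R) (m n : lattice).
Implicit Types (e P Q : set (plane R)).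

Lemma zvecD m n : zvec (m + n) = zvec m + zvec n :> plane R.
Proof. by rewrite /zvec /= !intrD. Qed.

Lemma zvecMn n (k : nat) : zvec (n *+ k) = k%:R *: zvec n :> plane R.
Proof.
elim: k => [|k IH]; first by rewrite scale0r.
by rewrite mulrS zvecD IH mulrS scalerDl scale1r.
Qed.

(** The gradient [m0 + n] lies [1 / k] of the way from [m0] to [m1]; interpolating the constant in
    the same proportion gives a convex combination of the two terms, strict when [k > 1]. *)
Lemma aff_between m0 c0 m1 c1 n (k : nat) x : (0 < k)%N -> m1 - m0 = n *+ k ->
  aff (m0 + n) (c0 + (c1 - c0) / k%:R) x =
  aff m0 c0 x + (aff m1 c1 x - aff m0 c0 x) / k%:R.
Proof.
move=> k0 e; have k0' : k%:R != 0 :> R by rewrite pnatr_eq0 -lt0n.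
have -> : m1 = m0 + n *+ k by rewrite -e addrC subrK.
rewrite /aff !zvecD zvecMn !(pairingC _ x).
rewrite -[in pairing x (zvec m0 + zvec n)](scale1r (zvec n)) !pairing_step.
by field.
Qed.

Variable P : set (plane R).
Hypothesis adm0 : exists G, admissible Omega P G.
Local Notation F := (tropical_relaxation Omega P).

Variables (e : set (plane R)) (m0 : lattice) (c0 : R) (m1 : lattice) (c1 : R).
Hypothesis He : edges Omega F e.
Hypothesis eO : closure e `<=` Omega°.
Hypothesis W : forall x, e x -> wedge F m0 c0 m1 c1 x.

Variables (n : lattice) (k : nat).
Hypothesis k1 : (1 < k)%N.
Hypothesis m01k : m1 - m0 = n *+ k.

Let m := m0 + n.
Let c := c0 + (c1 - c0) / k%:R.

Lemma edge_nonempty : exists x, e x.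
Proof. by case: He => x px <-; exists x; exact: connected_component_refl. Qed.

(** Both terms majorise [F], so a strict convex combination of them can be at most [F] only where
    both equal [F], that is on the closed edge. Were the common value not positive, [m0] and [m1]
    would both be zero. *)
Lemma edge_contact x : Omega x -> aff m c x <= F x ->
  closure e x /\ 0 < aff m c x.
Proof.
move=> Ox mx; have [x0 ex0] := edge_nonempty.
have Ox0 : Omega° x0 by apply: eO; exact: subset_closure.
have W0 := W ex0; have [m01 _ _] := W0.
have F0 y : Omega y -> F y <= aff m0 c0 y by exact: wedge_le W0.
have F1 y : Omega y -> F y <= aff m1 c1 y by exact: wedge_le (wedge_sym W0).
have [e0 e1] : F x = aff m0 c0 x /\ F x = aff m1 c1 x.
  move: mx (F0 x Ox) (F1 x Ox).
  rewrite (aff_between _ _ _ _ m01k)//; last exact: ltnW.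
  have k0' : 0 < k%:R^-1 :> R by rewrite invr_gt0 ltr0n ltnW.
  have k1' : k%:R^-1 < 1 :> R by rewrite invf_lt1 ?ltr1n// ltr0n ltnW.
  move: (F x) (aff m0 c0 x) (aff m1 c1 x) (k%:R^-1 : R) k0' k1'.
  move=> f a b t t0 t1 h fa fb.
  by have : a = f /\ b = f; [split; nra|move=> [-> ->]].
have cx := contact_closure_edge hOmega adm0 He ex0 W0 Ox e0 e1.
split => //.
have -> : aff m c x = F x.
  by rewrite (aff_between _ _ _ _ m01k) ?(ltnW k1)// -e0 -e1 subrr mul0r addr0.
rewrite ltNge; apply/negP => Fx.
have Oix := eO cx.
have nO : \forall y \near x, Omega y := Oix.
have h0 : zvec m0 = 0 :> plane R.
  apply: (superdifferential_zero Oix (relaxation_ge0 adm0) Fx).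
  apply: superdifferential_touching e0 _ => //.
  by apply: filterS nO => y; exact: F0.
have h1 : zvec m1 = 0 :> plane R.
  apply: (superdifferential_zero Oix (relaxation_ge0 adm0) Fx).
  apply: superdifferential_touching e1 _ => //.
  by apply: filterS nO => y; exact: F1.
by move/eqP: m01; apply; apply: (@zvec_inj R); rewrite h0 h1.
Qed.

Hypothesis Pp : forall x, P x ->
  (corner_locus Omega F `\` graph_vertex Omega F) x.

(** Without a marked point on [e], the intermediate term could be inserted while keeping all corners
    at [P], although it touches [F] along [e]. *)
Lemma edge_marked : closed P -> exists x, P x /\ e x.
Proof.
move=> cP; apply: contrapT => noP; have [x ex] := edge_nonempty.
have Ox : Omega x by apply: interior_subset; apply: eO; exact: subset_closure.
have := @relaxation_insert _ _ hOmega _ m c adm0 cP _ _ Ox.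
have -> : aff m c x = F x.
  have [_ e01 _] := W ex.
  rewrite (aff_between _ _ _ _ m01k) ?(ltnW k1)// -e01 subrr mul0r addr0.
  by rewrite (wedge_value (W ex)).
rewrite ltxx => ltF; suff: false by [].
apply: ltF => y Oy /(edge_contact Oy)[cy y0]; split => //; first exact: eO.
move=> Py; apply: noP; exists y; split => //.
exact: (edge_closure_plain He cy (Pp Py)).
Qed.

(** Off the line where the two terms agree, the intermediate term lies strictly above [F] near [p],
    and for [q] close to [p] the gap is within the margin [d0] of [relaxation_move]. *)
Lemma edge_move Q p : closed Q -> Q `<=` P -> (forall x, Q x -> ~ e x) -> e p ->
  \forall q \near p, aff m0 c0 q != aff m1 c1 q ->
    forall P', P' `<=` Q `|` [set q] -> forall x, Omega x ->
    tropical_relaxation Omega P' x <= F x.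
Proof.
move=> cQ QP Qe ep.
have Op : Omega° p by apply: eO; exact: subset_closure.
have [m01 e01 hF] := W ep.
have mp : aff m c p = F p.
  rewrite (aff_between _ _ _ _ m01k) ?(ltnW k1)// -e01 subrr mul0r addr0.
  by rewrite (wedge_value (W ep)).
have [|//||d0 d00 move_p] :=
    relaxation_move hOmega adm0 cQ QP (m := m) (c := c) (p := p).
- move=> x Ox /(edge_contact Ox)[cx x0]; split => //; first exact: eO.
  move=> Qx; apply: (Qe _ Qx).
  exact: (edge_closure_plain He cx (Pp (QP _ Qx))).
- exact: interior_subset.
- by rewrite mp.
have k0' : 0 < k%:R^-1 :> R by rewrite invr_gt0 ltr0n ltnW.
have k1' : k%:R^-1 < 1 :> R by rewrite invf_lt1 ?ltr1n// ltr0n ltnW.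
have near0 : \forall q \near p, aff m c q < aff m0 (c0 + d0) q.
  apply: near_aff_lt; rewrite mp (wedge_value (W ep)) /aff ltrD2r.
  by rewrite ltrDl.
have near1 : \forall q \near p, aff m c q < aff m1 (c1 + d0) q.
  apply: near_aff_lt; rewrite mp (wedge_value (wedge_sym (W ep))) /aff ltrD2r.
  by rewrite ltrDl.
near=> q => ne P' P'Q.
have Fq : F q = Num.min (aff m0 c0 q) (aff m1 c1 q) by near: q.
apply: (move_p q) => //.
- by near: q; exact: near_near.
- move: ne; rewrite Fq (aff_between _ _ _ _ m01k) ?(ltnW k1)//.
  move: (aff m0 c0 q) (aff m1 c1 q) (k%:R^-1 : R) k0' k1' => a b t t0 t1.
  by case: (ltgtP a b) => // ab _; nra.
- have h0 : aff m c q < aff m0 (c0 + d0) q by near: q.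
  have h1 : aff m c q < aff m1 (c1 + d0) q by near: q.
  rewrite Fq; case: (leP (aff m0 c0 q) (aff m1 c1 q)) => _.
    by move: h0; rewrite /aff; lra.
  by move: h1; rewrite /aff; lra.
Unshelve. all: by end_near. Qed.

End EdgeContact.

(** * Interiority of a closed face, read off from its incidences with the boundary *)

Section Boundary.
Context {R : realType}.
Variable Omega : set (plane R).
Hypothesis hOmega : rational_polygon Omega.
Implicit Types (x y z u v w q : plane R) (t : R) (f g : set (plane R)).

Lemma finite_closed (A : set (plane R)) : finite_set A -> closed A.
Proof. by move=> /finite_compact; apply: compact_closed; exact: norm_hausdorff. Qed.

(* A boundary point lies on a tight constraint, whose zero set is either a side
   or the point itself, which is then a vertex. *)
Lemma closure_interior_transfer f g :
  closure f `<=` Omega° -> g `<=` Omega ->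
  (forall S, polygon_side Omega S ->
     (closure f `&` S !=set0 <-> closure g `&` S !=set0)) ->
  (forall q, polygon_vertex Omega q -> (closure f q <-> closure g q)) ->
  closure g `<=` Omega°.
Proof.
move=> fO gO side vert y gy.
have Oy : Omega y.
  have cO : closed Omega.
    by apply: compact_closed; [exact: norm_hausdorff|exact: polygon_compact].
  by apply: cO; exact: closure_subset gy.
apply: contrapT => nOy.
have [[s [n [a [prim OE]]]] _ _] := hOmega.
have ge0 (r : 'I_s) x : Omega x -> 0 <= pairing (zvec (n r)) x + a r.
  by rewrite OE; exact.
have [r yr] : exists r, pairing (zvec (n r)) y + a r = 0.
  apply: contrapT => tight; apply: nOy.
  have pos (r : 'I_s) : \forall x \near y, 0 < pairing (zvec (n r)) x + a r.
    have lc : pairing (zvec (n r)) x + a r @[x --> y] -->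
        pairing (zvec (n r)) y + a r.
      by apply: cvgD; [exact: pairing_continuous|exact: cvg_cst].
    apply: (cvgr_gt _ lc); rewrite lt_neqAle ge0// andbT eq_sym.
    by apply/eqP => yr; apply: tight; exists r.
  have : \forall x \near y, forall r : 'I_s, 0 < pairing (zvec (n r)) x + a r.
    exact: filter_forall pos.
  by apply: filterS => x h; rewrite OE => r; apply/ltW/h.
have nr0 : zvec (n r) != 0 :> plane R.
  apply/eqP => z0; have := prim r.
  by rewrite (_ : n r = 0)//; apply: (@zvec_inj R); rewrite z0.
have noint z : Omega° z -> pairing (zvec (n r)) z + a r = 0 -> False.
  move=> Oz zr; move/eqP: nr0; apply.
  apply: (@touching_gradient0 _ _ (a r) z); last by rewrite addrC zr.
  by apply: filterS Oz => x /(ge0 r); rewrite addrC.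
pose S := [set x | Omega x /\ pairing (zvec (n r)) x + a r = 0].
have [[z [[Oz zr] zy]]|single] := pselect (exists z, S z /\ z != y).
  have pS : polygon_side Omega S.
    exists (zvec (n r)), (a r); split => //; first exact: ge0.
    by exists z, y.
  have [|w [fw [_ wr]]] := (side _ pS).2; first by exists y.
  exact: noint (fO _ fw) wr.
have Sy x : S x -> x = y.
  by move=> Sx; apply/eqP/negPn/negP => xy; apply: single; exists x.
have pv : polygon_vertex Omega y.
  split => // x z t Ox Oz /andP[t0 t1] yE.
  have gx := ge0 r _ Ox; have gz := ge0 r _ Oz.
  have := yr; rewrite yE -/(seg x z t) pairing_seg => e0.
  have t1' : 0 < 1 - t by rewrite subr_gt0.
  have [xr zr] : pairing (zvec (n r)) x + a r = 0 /\
      pairing (zvec (n r)) z + a r = 0.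
    move: e0 gx gz; move: (pairing _ x) (pairing _ z) (a r).
    by move=> ? ? ? ? ? ?; split; nra.
  by rewrite (Sy x)// (Sy z).
by apply: nOy; apply: fO; apply/vert.
Qed.

End Boundary.

(** * Countability from local maxima *)

Section Countability.
Context {R : realType}.
Implicit Types (D : set R) (s t : R).

(* A point is determined by a rational interval around it on which it is a
   maximiser of both functions. *)
Lemma countable_local_maxima D (a b : R -> R) :
  (forall s, D s -> exists2 r, 0 < r &
     forall t, D t -> `|t - s| < r -> a t <= a s /\ b t <= b s) ->
  (forall s t, D s -> D t -> a s = a t -> b s = b t -> s = t) -> countable D.
Proof.
move=> locmax inj.
have /choice[f Hf] : forall s, exists qq : rat * rat, D s ->
    ratr qq.1 < s < ratr qq.2 /\
    forall t, D t -> ratr qq.1 < t < ratr qq.2 -> a t <= a s /\ b t <= b s.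
  move=> s; have [Ds|nDs] := pselect (D s); last by exists (0, 0).
  have [r r0 h] := locmax _ Ds.
  have [q1] : exists q : rat, ratr q \in `]s - r, s[.
    by apply: rat_in_itvoo; rewrite ltrBlDr ltrDl.
  have [q2] : exists q : rat, ratr q \in `]s, s + r[.
    by apply: rat_in_itvoo; rewrite ltrDl.
  rewrite !in_itv /= => /andP[h1 h2] /andP[h3 h4].
  exists (q1, q2) => _ /=; split; first by rewrite h4 h1.
  move=> t Dt /andP[t1 t2]; apply: h => //.
  by rewrite ltr_norml; apply/andP; split; lra.
apply/countable_injP; exists (pickle \o f) => s t /set_mem Ds /set_mem Dt /=.
move=> /(pcan_inj (@pickleK _)) fst.
have [s1 s2] := Hf _ Ds; have [t1 t2] := Hf _ Dt.
have [as1 bs1] : a s <= a t /\ b s <= b t by apply: t2 => //; rewrite -fst.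
have [at1 bt1] : a t <= a s /\ b t <= b s by apply: s2 => //; rewrite fst.
by apply: inj => //; apply/eqP; rewrite eq_le ?as1 ?at1 ?bs1 ?bt1.
Qed.

Lemma uncountable_itv (r : R) : 0 < r -> ~ countable [set s : R | `|s| < r].
Proof.
move=> r0 /(@countable_lebesgue_measure0 R).
have -> : [set s : R | `|s| < r] = [set` `]-r, r[ ].
  by apply/seteqP; split => s /=; rewrite in_itv /= ltr_norml.
rewrite lebesgue_measure_itv /= lte_fin gtrN// -EFinB => /eqP.
by rewrite eqe subr_eq0 gt_eqF// gtrN.
Qed.

End Countability.

Lemma lattice_multiple (v : int * int) : v != 0 ->
  exists n k, [/\ (0 < k)%N, primitive n & v = n *+ k].
Proof.
case: v => a b v0; pose g := gcdz a b.
have g0 : g != 0 by rewrite gcdz_eq0; apply: contra v0 => /andP[/eqP -> /eqP ->].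
have gE : (`|g|%N : int) = g by rewrite /g /gcdz.
have ea : (a %/ g)%Z * g = a by rewrite divzK// dvdz_gcdl.
have eb : (b %/ g)%Z * g = b by rewrite divzK// dvdz_gcdr.
have gM (x : int) : x *+ `|g|%N = x * g by rewrite -{2}gE -mulr_natr natz.
exists ((a %/ g)%Z, (b %/ g)%Z), `|g|%N; split; first by rewrite absz_gt0.
  rewrite /primitive /coprimez /=; apply/eqP/(mulIf g0).
  by have := mulz_gcdl (a %/ g)%Z (b %/ g)%Z g; rewrite ea eb gE mul1r.
transitivity ((a %/ g)%Z *+ `|g|%N, (b %/ g)%Z *+ `|g|%N).
  by rewrite !gM ea eb.
by elim: `|g|%N => [|k IH]; rewrite ?mulr0n// !mulrS -IH.
Qed.

(** * Transport of an edge to a displaced configuration *)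

Section Perturbation.
Context {R : realType}.
Variable Omega : set (plane R).
Hypothesis hOmega : rational_polygon Omega.
Context {N : nat}.
Implicit Types (x y : plane R) (s t : R) (p : 'I_N -> plane R).

Local Notation F p := (tropical_relaxation Omega (range p)).
Local Notation plain G := (corner_locus Omega G `\` graph_vertex Omega G).

Definition move_point p (i : 'I_N) (u : plane R) s (j : 'I_N) : plane R :=
  if j == i then p i + s *: u else p j.

Lemma range_closed p : closed (range p).
Proof. by apply: finite_closed; apply: finite_image; exact: finite_finset. Qed.

(** Cell gradients are part of the type, so the two adjacent flat regions go to cells of gradients
    [m0] and [m1], only the constants being free to change. Face incidences place the image edge in
    both closures, and boundary incidences keep its closure interior. *)
Lemma same_type_edge p (p' : 'I_N -> plane R) e m0 c0 m1 c1 i : m0 != m1 ->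
  (exists G, admissible Omega (range p) G) ->
  edges Omega (F p) e -> closure e `<=` Omega° ->
  (forall x, e x -> wedge (F p) m0 c0 m1 c1 x) ->
  e (p i) -> (forall j, j != i -> ~ e (p j)) ->
  (forall j, exists2 e', edges Omega (F p) e' & e' (p j)) ->
  same_type Omega p p' ->
  exists e' c0' c1', [/\ edges Omega (F p') e', closure e' `<=` Omega°,
    forall x, e' x -> wedge (F p') m0 c0' m1 c1' x,
    e' (p' i) /\ (forall j, j != i -> ~ e' (p' j)) &
    forall j, plain (F p') (p' j)].
Proof.
move=> m01 adm0 He eO W epi epj onE [phi [[iso _] grad _ bd mark]].
have [bcells bedges _ inc] := iso.
have cell_face U : cells Omega (F p) U -> faces Omega (F p) U by do 2 left.
have edge_face f : edges Omega (F p) f -> faces Omega (F p) f by left; right.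
have phi_edge f : edges Omega (F p) f -> edges Omega (F p') (phi f).
  by case: bedges => + _ _; apply.
have phi_cell f : cells Omega (F p) f -> cells Omega (F p') (phi f).
  by case: bcells => + _ _; apply.
have plain' j : plain (F p') (p' j).
  have [f Hf fj] := onE j.
  by apply: (edge_sub (phi_edge _ Hf)); apply/mark => //; exact: edge_face.
have adm' : exists G, admissible Omega (range p') G.
  by apply: (admissible_exists (x := p' i)); case: (plain' i).
have Opi : Omega° (p i) by apply: eO; exact: subset_closure.
have flat_case m c : closure (flat Omega (range p) m c) (p i) ->
    (forall x, e x -> closure (flat Omega (range p) m c) x) ->
    exists c' U, [/\ open U, forall x, U x -> F p' x = aff m c' x
      & phi e `<=` closure U].
  move=> cl ecl; have ne : flat Omega (range p) m c !=set0.
    by have [x [fx _]] := cl _ filterT; exists x.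
  have cU := flat_cell hOmega adm0 ne.
  have [|c' Uc'] := (grad _ m cU).1.
    by exists c => y /flat_sub[].
  exists c', (phi (flat Omega (range p) m c)); split => //.
    by case: (phi_cell _ cU) => -[].
  apply: subset_trans (@subset_closure _ _) _.
  apply: (inc _ _ (edge_face _ He) (cell_face _ cU)).1.
  move=> y cy; apply: closed_closure.
  by apply: closure_subset cy; exact: ecl.
have eint x : e x -> Omega° x by move=> ex; apply: eO; exact: subset_closure.
have W0 x : e x -> closure (flat Omega (range p) m0 c0) x.
  by move=> ex; apply: wedge_closure_flat (W _ ex); exact: eint.
have W1 x : e x -> closure (flat Omega (range p) m1 c1) x.
  by move=> ex; apply: wedge_closure_flat (wedge_sym (W _ ex)); exact: eint.
have [c0' [U0 [op0 F0 k0]]] := flat_case _ _ (W0 _ epi) W0.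
have [c1' [U1 [op1 F1 k1]]] := flat_case _ _ (W1 _ epi) W1.
exists (phi e), c0', c1'; split => //; first exact: phi_edge.
- apply: (@closure_interior_transfer _ _ hOmega e) => //.
  + move=> y /(edge_sub (phi_edge _ He)) [[Oy _] _]; exact: interior_subset Oy.
  + by move=> S /(bd _ (edge_face _ He)).1.
  + by move=> q /(bd _ (edge_face _ He)).2.
- move=> x ex.
  apply: (closures_wedge hOmega adm' _ m01 op0 op1 (k0 _ ex) (k1 _ ex)) => //.
  exact: edge_sub (phi_edge _ He) _ ex.
- split; first by apply/mark => //; exact: edge_face.
  by move=> j ji /(mark _ _ (edge_face _ He)); exact: epj.
Qed.

End Perturbation.

Theorem corollary6p14 (R : realType) (Omega : set (plane R))
    (hOmega : rational_polygon Omega)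
    (N : nat) (hN : (0 < N)%N) (p : 'I_N -> plane R)
    (hp : strongly_generic Omega p) :
  let F := tropical_relaxation Omega (range p) in
  (forall e : set (plane R), edges Omega F e -> closure e `<=` Omega° ->
     edge_weight Omega F e 1) /\
  (forall v : plane R, graph_vertex Omega F v ->
     forall m : int * int, ~ (superdifferential Omega F v)° (zvec m)).
Proof.
move: hp => [[_ Op] onE distinct [eps eps0 stable]] F.
have plainp j : (corner_locus Omega F `\` graph_vertex Omega F) (p j).
  by have [f Hf fj] := onE j; exact: edge_sub Hf _ fj.
have adm0 : exists G, admissible Omega (range p) G.
  by apply: (@admissible_exists _ _ _ (p (Ordinal hN))); case: (plainp (Ordinal hN)).
split; last first.
  move=> v vv m; apply: vertex_no_interior_lattice_point => //.
    exact: range_closed.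
  by move=> [j _ pj]; have [_] := plainp j; rewrite pj.
move=> e He eO.
have [m0 [c0 [m1 [c1 [m01 W]]]]] := edge_wedge hOmega adm0 He.
(* The multiplicity [k] of the gradient jump is the weight; the case [k = 1] gives the claim and any
   larger [k] is refuted. *)
have [|n [k [k0 prim mk]]] := @lattice_multiple (m1 - m0).
  by rewrite subr_eq0 eq_sym.
have [k_eq1|k_neq1] := eqVneq k 1%N.
  have eint x : e x -> Omega° x by move=> ex; apply: eO; exact: subset_closure.
  have W0 x : e x -> closure (flat Omega (range p) m0 c0) x.
    by move=> ex; apply: wedge_closure_flat (W _ ex); exact: eint.
  have W1 x : e x -> closure (flat Omega (range p) m1 c1) x.
    by move=> ex; apply: wedge_closure_flat (wedge_sym (W _ ex)); exact: eint.
  have [x ex] := edge_nonempty He.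
  have [y0 [fy0 _]] := W0 _ ex _ filterT; have [y1 [fy1 _]] := W1 _ ex _ filterT.
  exists (flat Omega (range p) m0 c0), (flat Omega (range p) m1 c1), m0, m1, n.
  split => //; last by rewrite mk k_eq1.
  - split; [by apply: flat_cell => //; exists y0|by apply: flat_cell => //; exists y1|].
    move=> E; move/eqP: m01; apply; have fy1' := fy0; rewrite E in fy1'.
    have [] // := @near_aff_eq _ m0 c0 m1 c1 y0.
    near=> z; transitivity (F z).
      have fz : flat Omega (range p) m0 c0 z by near: z; exact: near_near.
      by rewrite -(flat_sub fz).2.
    have fz : flat Omega (range p) m1 c1 z by near: z; exact: near_near.
    exact: (flat_sub fz).2.
  - by split; [exists c0|exists c1] => y /flat_sub[_ Fy]; exact: Fy.
have k1 : (1 < k)%N by rewrite ltn_neqAle eq_sym k_neq1.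
exfalso.
have Pp x : range p x -> (corner_locus Omega F `\` graph_vertex Omega F) x.
  by move=> [j _ <-]; exact: plainp.
have [_ [[i _ <-] epi]] :=
  edge_marked hOmega adm0 He eO W k1 mk Pp (@range_closed _ _ p).
have epj j : j != i -> ~ e (p j).
  by move=> ji epj; apply: (distinct i j e _ He epi epj); rewrite eq_sym.
(* The gradient jump is normal to the edge, so a nonzero multiple of [u] moves [p i] off the line
   carrying [e]. *)
pose u : plane R := zvec m1 - zvec m0.
have uu : 0 < pairing u u.
  rewrite ltNge pairing_self_eq0 subr_eq0.
  by apply: contra m01 => /eqP /zvec_inj ->.
have uE : pairing u u = pairing (zvec m1) u - pairing (zvec m0) u.
  by rewrite {2}/u pairing_sub !(pairingC u).
have [r r0 hr] := near_step u (nbhsx_ballx (p i) _ eps0).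
pose q s := move_point p i u s.
have qi s : q s i = p i + s *: u by rewrite /q /move_point eqxx.
have qj s j : j != i -> q s j = p j by rewrite /q /move_point => /negbTE ->.
(* For each small [s], an edge through the displaced point and its two constants; larger [s] get a
   default triple. *)
have /choice[f Hf] s : exists ecc : set (plane R) * R * R, `|s| < r ->
    let: (e', c0', c1') := ecc in
    let G := tropical_relaxation Omega (range (q s)) in
    [/\ edges Omega G e', closure e' `<=` Omega°,
      forall x, e' x -> wedge G m0 c0' m1 c1' x,
      e' (q s i) /\ (forall j, j != i -> ~ e' (q s j)) &
      forall j, (corner_locus Omega G `\` graph_vertex Omega G) (q s j)].
  have [sr|nsr] := pselect (`|s| < r); last by exists (set0, 0, 0).
  have st : same_type Omega p (q s).
    apply: stable => j; have [->|ji] := eqVneq j i; first by rewrite qi; exact: hr.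
    by rewrite qj//; exact: ballxx.
  have [e' [c0' [c1' H]]] := same_type_edge hOmega m01 adm0 He eO W epi epj onE st.
  by exists (e', c0', c1').
(* The two terms agree at the displaced point, which lies on its edge; this makes the difference of
   the constants affine in [s] with slope [pairing u u]. *)
have balance s : `|s| < r ->
    (f s).1.2 - (f s).2 = pairing u (p i) + s * pairing u u.
  move=> /(Hf s); case: (f s) => -[e' c0'] c1' /= [_ _ W' [/W' + _] _] => -[_ + _].
  have -> : pairing u (p i) = pairing (zvec m1) (p i) - pairing (zvec m0) (p i).
    by rewrite pairingC pairing_sub !(pairingC (p i)).
  by rewrite qi /aff !pairing_step uE; lra.
apply: (uncountable_itv r0).
apply: (@countable_local_maxima _ _ (fun s => (f s).1.2) (fun s => (f s).2)).
  move=> s sr /=; have := Hf s sr.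
  case fE: (f s) => [[e' c0'] c1'] /= [He' eO' W' [ei ej] pl].
  have adms : exists G, admissible Omega (range (q s)) G.
    by apply: (@admissible_exists _ _ _ (q s i)); case: (pl i).
  have Pps x : range (q s) x -> (corner_locus Omega
      (tropical_relaxation Omega (range (q s))) `\` graph_vertex Omega
      (tropical_relaxation Omega (range (q s)))) x.
    by move=> [j _ <-]; exact: pl.
  pose Q := [set q s j | j in [set j | j != i]].
  have cQ : closed Q by apply: finite_closed; apply: finite_image; exact: finite_finset.
  have QP : Q `<=` range (q s) by move=> _ [j _ <-]; exists j.
  have Qe x : Q x -> ~ e' x by move=> [j ji <-]; exact: ej.
  have [rho rho0 hrho] :=
    near_step u (edge_move hOmega adms He' eO' W' k1 mk Pps cQ QP Qe ei).
  exists rho => // t tr ts.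
  (* [edge_move] asks for a new point off the line of the current edge, so [t = s] is treated
     apart. *)
  have [->|nts] := eqVneq t s; first by rewrite fE.
  have qst : q s i + (t - s) *: u = q t i.
    by rewrite !qi -addrA -scalerDl (addrC s) subrK.
  have Osi : Omega° (q s i) by have [[]] := pl i.
  have Ws := W' _ ei.
  have := Hf t tr; case: (f t) => [[et a] b] /= [_ _ Wt [eti _] plt].
  have Oti : Omega° (q t i) by have [[]] := plt i.
  have le x : Omega x -> tropical_relaxation Omega (range (q t)) x <=
      tropical_relaxation Omega (range (q s)) x.
    apply: (hrho _ ts).
      rewrite -subr_eq0 /aff !pairing_step; have [_ e01 _] := Ws.
      have -> : c0' + (pairing (zvec m0) (q s i) + (t - s) * pairing (zvec m0) u) -
          (c1' + (pairing (zvec m1) (q s i) + (t - s) * pairing (zvec m1) u)) =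
          - ((t - s) * pairing u u).
        by rewrite uE; move: e01; rewrite /aff; lra.
      by rewrite oppr_eq0 mulf_neq0 ?subr_eq0// gt_eqF.
    move=> _ [j _ <-]; have [->|ji] := eqVneq j i; first by right; rewrite qst.
    by left; exists j => //; rewrite !qj.
  have Oti' := interior_subset Oti.
  (* At [q t i] the relaxation for [t] equals its own terms, while the one for [s] is bounded by its
     corresponding terms; the gradients being the same, the constants compare. *)
  have Wti := Wt _ eti; split.
    have := le_trans (le _ Oti') (wedge_le hOmega adms Osi Ws Oti').
    by rewrite (wedge_value Wti) /aff lerD2r.
  have := le_trans (le _ Oti') (wedge_le hOmega adms Osi (wedge_sym Ws) Oti').
  by rewrite (wedge_value (wedge_sym Wti)) /aff lerD2r.
(* Equal constants give equal differences, and [balance] recovers the parameter because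
   [pairing u u] is positive. *)
move=> s t sr tr e1 e2; have := balance s sr; have := balance t tr.
rewrite /= in e1 e2; rewrite e1 e2 => -> /addrI /mulIf -> //.
by rewrite gt_eqF.
Unshelve. all: by end_near. Qed.
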